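(* Let $A$ be a nondegenerate polarized Hopf algebra with $T=\mathrm{Spec}\,A_0$ connected, with a quasitriangular structure $\mathcal R\in A_{\ge0}\hat\otimes A_{\le 0}$, and let $\mathcal O_0\subset\mathcal O$ be a full abelian tensor subcategory which is semisimple and all of whose objects are finite dimensional. Let $V,W\in Ir$ be irreducible modules in $\mathcal O_0$, and let $R_{V,W}(\lambda)=J^{-1}_{V,W}(\lambda)\,\mathcal R^{21}|_{V\otimes W}\,J^{21}_{W,V}(\lambda)$ be the exchange matrix. Then in $\mathrm{End}(V)\otimes\mathrm{End}(W)\otimes E(\mathcal O_0)$ $$R^{12}_{V,W}(\lambda^1)(L^V)^{13}(L^W)^{23}=\;:(L^W)^{23}(L^V)^{13}R^{12}_{V,W}(\lambda^2):,$$ where $:\ :$ means that the matrix elements of $R$ are placed to the left of those of $L$. Explicitly, if $L^V=\sum E^V_{ij}\otimes L^V_{ij}$, $L^W=\sum E^W_{kl}\otimes L^W_{kl}$ and $R_{V,W}(\lambda)=\sum E^V_{ij}\otimes E^W_{kl}\otimes R_{ijkl}(\lambda)$, then for all $i,k,j',l'$ $$\sum_{j,l}R_{ijkl}(\lambda^1)L^V_{jj'}L^W_{ll'}=\sum_{j,l}R_{jj'll'}(\lambda^2)L^W_{kl}L^V_{ij}.$$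
   Context: All algebras are over $\mathbb C$. A polarized Hopf algebra is a Hopf algebra $A$ (coproduct $\Delta$, counit $\epsilon$, antipode $S$) such that: (I) $A=\oplus_{k\in\mathbb Z}A[k]$ is $\mathbb Z$-graded; (II) there are graded subalgebras $A_0,A_+,A_-$ such that the multiplication maps $A_+\otimes A_0\otimes A_-\to A$ and $A_-\otimes A_0\otimes A_+\to A$ are isomorphisms of vector spaces, and the graded components of $A_\pm$ are finite dimensional; (III) $\ker\epsilon\cap A_+$ has only elements of positive degree, $\ker\epsilon\cap A_-$ only of negative degree, $A_0$ only of degree zero; (IV) $A_0$ is a commutative cocommutative finitely generated Hopf algebra; (V) $A_{\ge0}=A_0A_+$ and $A_{\le0}=A_0A_-$ are Hopf subalgebras. $T=\mathrm{Spec}\,A_0$ is a commutative affine algebraic group, written additively; its points are characters of $A_0$. $V[\lambda]$ denotes the $\lambda$-weight space of an $A_0$-module. $\chi^\pm_\lambda=\mathbb C v^\pm_\lambda$ is the one-dimensional $A_0A_\pm$-module on which $A_0$ acts by $\lambda$ and $A_\pm$ by $\epsilon$; Verma modules are $M^\pm_\lambda=A\otimes_{A_0A_\pm}\chi^\pm_\lambda$, graded with $\deg v_\lambda^\pm=0$; $(v^\pm_\lambda)^*$ is the degree-zero element of the restricted dual with $\langle (v^\pm_\lambda)^*,v^\pm_\lambda\rangle=1$. $A$ is nondegenerate if $M^\pm_\lambda$ are irreducible for generic $\lambda$ (outside a countable union of lower-dimensional algebraic sets). $\mathcal O$: $\mathbb Z$-graded $A$-modules with grading bounded from above, diagonalizable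 over $A_0$. For $v\in V[\lambda_v]$, $V\in\mathcal O$, generic $\lambda$, $\Phi^v_\lambda:M^+_\lambda\to M^+_{\lambda-\lambda_v}\otimes V$ is the unique $A$-homomorphism with $\langle (v^+_{\lambda-\lambda_v})^*\otimes 1,\Phi^v_\lambda v^+_\lambda\rangle=v$. The fusion matrix $J_{W,V}(\lambda)\in\mathrm{End}(W\otimes V)$ is defined by $J_{W,V}(\lambda)(w\otimes v)=u$ where $(\Phi^w_{\lambda-\lambda_v}\otimes1)\Phi^v_\lambda=\Phi^u_\lambda$; it is invertible and rational in $\lambda$; $J^{21}_{W,V}=PJ_{W,V}P$, $P$ the permutation of factors. A quasitriangular structure is an invertible $\mathcal R$ in the completed tensor square $A\hat\otimes A$ (projective limit of $A/I_n\otimes A/I_n$ in each degree, $I_n=A\cdot\oplus_{j\ge n}A[j]$) with $\mathcal R\Delta(a)=\Delta^{op}(a)\mathcal R$, $(\Delta\otimes1)\mathcal R=\mathcal R^{13}\mathcal R^{23}$, $(1\otimes\Delta)\mathcal R=\mathcal R^{13}\mathcal R^{12}$. Definition of $E=E(\mathcal O_0)$. Let $Ir$ be the set of (isomorphism classes of) irreducible modules in $\mathcal O_0$, $M_T$ the field of meromorphic functions on $T$. As a vector space $E=M_T\otimes_{\mathbb C}M_T\otimes_{\mathbb C}\bar E$, $\bar E=\oplus_{U\in Ir}U\otimes U^*$. For the trivial module $\mathbb C_A=\mathbb C e$, write $f(\lambda^1)=f\otimes1\otimes e\otimes e^*$ and $f(\lambda^2)=1\otimes f\otimes e\otimes e^*$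 for $f\in M_T$. Choose for each $U\in Ir$ a basis $v^U_i$ homogeneous for $T$ and the $\mathbb Z$-grading, with weights $\omega^U_i\in T$; put $L^U_{ij}=1\otimes1\otimes v^U_i\otimes(v^U_j)^*$ and $L^U=\sum_{i,j}E^U_{ij}\otimes L^U_{ij}\in\mathrm{End}(U)\otimes\bar E$, where $E^U_{ij}v^U_k=\delta_{jk}v^U_i$. An element $f\otimes g\otimes v_i^U\otimes (v_j^U)^*$ is $f(\lambda^1)g(\lambda^2)L^U_{ij}$. The multiplication (which is associative) is determined by: $f(\lambda^1)$ and $g(\lambda^2)$ commute with each other and multiply as functions; $f(\lambda^1)L^U_{ij}=L^U_{ij}f(\lambda^1+\omega^U_i)$, $f(\lambda^2)L^U_{ij}=L^U_{ij}f(\lambda^2+\omega^U_j)$; and, for $V,W\in Ir$, in $\mathrm{End}(W)\otimes\mathrm{End}(V)\otimes E$, $$(L^V)^{23}(L^W)^{13}=\;:(J^{12}_{W,V}(\lambda^1))^{-1}\sum_{U\in Ir}(\tau^U_{W,V})^{12}(\mathrm{Id}_{H^U_{W,V}}\otimes L^U)(\bar\tau^U_{W,V})^{12}J^{12}_{W,V}(\lambda^2):,$$ where $H^U_{W,V}=\mathrm{Hom}_A(U,W\otimes V)$, $\tau^U_{W,V}:H^U_{W,V}\otimes U\to W\otimes V$, $h\otimes u\mapsto h(u)$, $\bar\tau^U_{W,V}:W\otimes V\to H^U_{W,V}\otimes U$ is the projection along the other isotypic components, and the normal ordering $:\ :$ means that in each matrix element all functions of $\lambda^1,\lambda^2$ are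 placed to the left of the elements $L^U_{ij}$. *)

(* Defs.v *)
From HB Require Import structures.
From mathcomp Require Import all_boot all_order all_algebra generic_quotient.
From mathcomp Require Import finmap complex.
From mathcomp Require Import all_classical all_reals topology normedtype derive.

Set Implicit Arguments.
Unset Strict Implicit.
Unset Printing Implicit Defensive.

Import Order.TTheory GRing.Theory Num.Theory numFieldNormedType.Exports.
Local Open Scope classical_set_scope.
Local Open Scope ring_scope.
Local Open Scope quotient_scope.

Section Subspaces.
Variables (K : fieldType) (V : lmodType K).

Definition lspan (S : set V) : set V :=
  [set x | exists2 s : seq (K * V), (forall p, p \in s -> S p.2) &
                                    x = \sum_(p <- s) p.1 *: p.2].

Definition lsubspace (S : set V) : Prop :=
  S 0 /\ forall a x y, S x -> S y -> S (a *: x + y).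

Lemma lspan_subspace S : lsubspace (lspan S).
Proof.
split; first by exists [::] => //; rewrite big_nil.
move=> a _ _ [s sS ->] [t tS ->].
exists ([seq (a * p.1, p.2) | p <- s] ++ t).
  by move=> p; rewrite mem_cat => /orP[/mapP[q /sS ? ->]|/tS].
rewrite big_cat big_map scaler_sumr /=; congr (_ + _).
by apply: eq_bigr => p _; rewrite scalerA.
Qed.

Lemma sub_lspan S x : S x -> lspan S x.
Proof.
move=> Sx; exists [:: (1, x)]; last by rewrite big_seq1 scale1r.
by move=> p; rewrite inE => /eqP ->.
Qed.

Lemma lspan_min S S' : lsubspace S' -> S `<=` S' -> lspan S `<=` S'.
Proof.
move=> [S'0 S'D] sSS' _ [s sS ->]; elim: s sS => [|p s IH] sS.
  by rewrite big_nil.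
rewrite big_cons; apply: S'D; first by apply: sSS'; apply: sS; rewrite mem_head.
by apply: IH => q qs; apply: sS; rewrite inE qs orbT.
Qed.

End Subspaces.

Section QuotientSpace.
Variables (K : fieldType) (V : lmodType K) (S : set V).

Definition qrel (x y : V) : bool := `[< lspan S (x - y) >].

Let sS := lspan_subspace S.

Lemma qrel_refl : reflexive qrel.
Proof. by move=> x; apply/asboolP; rewrite subrr; case: sS. Qed.

Lemma qrel_sym : symmetric qrel.
Proof.
suff h x y : qrel x y -> qrel y x by move=> x y; apply/idP/idP; exact: h.
move=> /asboolP h; apply/asboolP.
by rewrite -opprB -scaleN1r -[X in lspan S X]addr0; apply: sS.2 => //; case: sS.
Qed.

Lemma qrel_trans : transitive qrel.
Proof.
move=> y x z /asboolP h1 /asboolP h2; apply/asboolP.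
have -> : x - z = 1 *: (x - y) + (y - z).
  by rewrite scale1r addrA subrK.
by apply: sS.2.
Qed.

Canonical qrel_equiv := EquivRel qrel qrel_refl qrel_sym qrel_trans.

Definition quotm := {eq_quot qrel}%qT.
HB.instance Definition _ := EqQuotient.on quotm.
HB.instance Definition _ := Choice.on quotm.

Definition qpi (x : V) : quotm := \pi_quotm x.

Lemma qpiP x y : qpi x = qpi y <-> lspan S (x - y).
Proof. by split => [/eqmodP/asboolP|h]; last by apply/eqmodP/asboolP. Qed.

Lemma qpi_repr q : qpi (repr q) = q.
Proof. exact: reprK. Qed.

Lemma repr_qpi x : lspan S (repr (qpi x) - x).
Proof. by apply/qpiP; rewrite qpi_repr. Qed.

Definition qadd (p q : quotm) : quotm := qpi (repr p + repr q).
Definition qopp (p : quotm) : quotm := qpi (- repr p).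
Definition qscale (a : K) (p : quotm) : quotm := qpi (a *: repr p).

Lemma qaddE x y : qadd (qpi x) (qpi y) = qpi (x + y).
Proof.
apply/qpiP; rewrite opprD addrACA -[X in lspan S (X + _)]scale1r.
by apply: sS.2; exact: repr_qpi.
Qed.

Lemma qscaleE a x : qscale a (qpi x) = qpi (a *: x).
Proof.
apply/qpiP; rewrite -scalerBr -[X in lspan S X]addr0.
by apply: sS.2; [exact: repr_qpi|case: sS].
Qed.

Lemma qoppE x : qopp (qpi x) = qpi (- x).
Proof.
have -> : - x = (-1) *: x by rewrite scaleN1r.
by rewrite -qscaleE /qopp /qscale scaleN1r.
Qed.

Lemma qpi_surj q : exists x, q = qpi x.
Proof. by exists (repr q); rewrite qpi_repr. Qed.

Lemma qaddA : associative qadd.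
Proof.
move=> p q r; have [x ->] := qpi_surj p; have [y ->] := qpi_surj q; have [z ->] := qpi_surj r.
by rewrite !qaddE addrA.
Qed.
Lemma qaddC : commutative qadd.
Proof.
by move=> p q; have [x ->] := qpi_surj p; have [y ->] := qpi_surj q; rewrite !qaddE addrC.
Qed.
Lemma qadd0 : left_id (qpi 0) qadd.
Proof. by move=> p; have [x ->] := qpi_surj p; rewrite qaddE add0r. Qed.
Lemma qaddN : left_inverse (qpi 0) qopp qadd.
Proof. by move=> p; have [x ->] := qpi_surj p; rewrite qoppE qaddE addNr. Qed.

HB.instance Definition _ := GRing.isZmodule.Build quotm qaddA qaddC qadd0 qaddN.

Lemma qpiD x y : qpi x + qpi y = qpi (x + y).
Proof. exact: qaddE. Qed.

Lemma qscaleA a b v : qscale a (qscale b v) = qscale (a * b) v.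
Proof. by have [w ->] := qpi_surj v; rewrite !qscaleE scalerA. Qed.
Lemma qscale1 : left_id 1 qscale.
Proof. by move=> p; have [v ->] := qpi_surj p; rewrite qscaleE scale1r. Qed.
Lemma qscaleDr : right_distributive qscale +%R.
Proof.
move=> a p q; have [u ->] := qpi_surj p; have [v ->] := qpi_surj q.
by rewrite qpiD !qscaleE qpiD scalerDr.
Qed.
Lemma qscaleDl v : {morph qscale^~ v : a b / a + b}.
Proof. by move=> a b; have [w ->] := qpi_surj v; rewrite !qscaleE qpiD scalerDl. Qed.

HB.instance Definition _ := GRing.Zmodule_isLmodule.Build K quotm
  qscaleA qscale1 qscaleDr qscaleDl.

Lemma qpi_linear : linear qpi.
Proof. by move=> a u v; rewrite -qpiD -qscaleE. Qed.
HB.instance Definition _ := GRing.isLinear.Build K V quotm _ qpi qpi_linear.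

End QuotientSpace.

Section FreeSpace.
Variables (K : fieldType) (X : Type).

Definition fin_supp : {pred X -> K^o} :=
  fun f => `[< finite_set [set x | f x != 0] >].

Lemma fin_supp_closed : submod_closed fin_supp.
Proof.
split; first by apply/asboolP; rewrite (_ : [set x | _] = set0) //;
  apply/seteqP; split => x //=; rewrite eqxx.
move=> a f g /asboolP hf /asboolP hg; apply/asboolP.
have h : finite_set ([set x | f x != 0] `|` [set x | g x != 0]).
  by rewrite finite_setU.
apply: sub_finite_set h => x /=.
have -> : (a *: f + g) x = a * f x + g x by [].
case: (eqVneq (f x) 0) => [-> /=|? _]; last by left.
by rewrite mulr0 add0r; right.
Qed.

HB.instance Definition _ := GRing.isSubmodClosed.Build K (X -> K^o) fin_supp
  fin_supp_closed.

Record free := Free { fval :> X -> K^o; _ : fval \in fin_supp }.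
HB.instance Definition _ := [isSub for fval].
HB.instance Definition _ := [Choice of free by <:].
HB.instance Definition _ := [SubChoice_isSubLmodule of free by <:].

Lemma fdelta_subproof (x : X) : (fun y => (`[< y = x >])%:R : K) \in fin_supp.
Proof.
apply/asboolP; apply: (@sub_finite_set _ _ [set x]); last exact: finite_set1.
by move=> y /=; case: asboolP => [-> //|_]; rewrite eqxx.
Qed.

Definition fdelta (x : X) : free := Free (fdelta_subproof x).

End FreeSpace.

Section FreeLift.
Variables (K : fieldType) (X : choiceType) (W : lmodType K) (f : X -> W).

Definition flift (z : free K X) : W := \sum_(x \in [set: X]) (z x : K) *: f x.

Lemma fliftE (s : {fset X}) (z : free K X) :
  (forall x, x \notin s -> z x = 0) -> flift z = \sum_(x <- s) (z x : K) *: f x.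
Proof. by move=> h; apply: fsbigTE => x /h ->; rewrite scale0r. Qed.

Lemma free_supp (z : free K X) : exists s : {fset X}, forall x, x \notin s -> z x = 0.
Proof.
case: z => z /= /asboolP zf; exists (fset_set [set x | z x != 0]) => x.
rewrite in_fset_set // => /negP h; apply/eqP; apply: contrapT => /negP zx.
by apply: h; rewrite inE.
Qed.

Lemma flift_linear : linear flift.
Proof.
move=> a u v; have [s hs] := free_supp u; have [t ht] := free_supp v.
have hs' x : x \notin (s `|` t)%fset -> u x = 0.
  by rewrite inE negb_or => /andP[/hs].
have ht' x : x \notin (s `|` t)%fset -> v x = 0.
  by rewrite inE negb_or => /andP[_ /ht].
rewrite (fliftE hs') (fliftE ht') (@fliftE (s `|` t)%fset); last first.
  move=> x hx.
  by rewrite (_ : (a *: u + v) x = a * u x + v x) // hs' // ht' // mulr0 addr0.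
rewrite scaler_sumr -big_split /=; apply: eq_bigr => x _.
by rewrite scalerA -scalerDl.
Qed.
HB.instance Definition _ := GRing.isLinear.Build K _ W _ flift flift_linear.

Lemma flift_delta x : flift (fdelta K x) = f x.
Proof.
rewrite (@fliftE [fset x]%fset); last first.
  by move=> y; rewrite inE /= => /negP h; case: asboolP => // /eqP.
by rewrite big_seq_fset1 /=; case: asboolP => //; rewrite scale1r.
Qed.

End FreeLift.

Lemma free_ind (K : fieldType) (X : choiceType) (P : free K X -> Prop) :
  P 0 -> (forall a x z, P z -> P (a *: fdelta K x + z)) -> forall z, P z.
Proof.
move=> P0 PD z; have [s hs] := free_supp z.
have -> : z = flift (@fdelta K X) z.
  apply/val_inj/funext => y /=; rewrite (fliftE _ hs).
  have -> : fval (\sum_(x <- s) (z x : K) *: fdelta K x) y =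
      \sum_(x <- s) (z x : K) * (`[< y = x >])%:R.
    elim/big_rec2: _ => // i u v _ <-.
    by [].
  have [ys|ys] := boolP (y \in s).
    rewrite (bigD1_seq y ys (fset_uniq s)) /=.
    rewrite asboolT // mulr1 big1 ?addr0 // => x /negP xy.
    by rewrite asboolF ?mulr0 // => yx; apply: xy; apply/eqP.
  rewrite hs // big1_seq // => x /andP[_ xs].
  by rewrite asboolF ?mulr0 // => yx; move: ys; rewrite yx xs.
by rewrite (fliftE _ hs); elim/big_rec: _ => // x u _; exact: PD.
Qed.

Section TensorProduct.
Variables (K : fieldType) (U V : lmodType K).
Local Notation d := (fun u v => fdelta K (u, v)).

Definition tens_rel : set (free K (U * V)%type) :=
  [set z | (exists a u u' v, z = d (a *: u + u') v - (a *: d u v + d u' v)) \/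
           (exists a u v v', z = d u (a *: v + v') - (a *: d u v + d u v'))].

Definition tensor := quotm tens_rel.
HB.instance Definition _ := GRing.Lmodule.on tensor.

Definition tens (u : U) (v : V) : tensor := qpi tens_rel (d u v).

Lemma tens_linl v : linear (tens^~ v).
Proof.
move=> a u u'; rewrite /tens -linearP; apply/qpiP.
by apply: sub_lspan; left; exists a, u, u', v.
Qed.

Lemma tens_linr u : linear (tens u).
Proof.
move=> a v v'; rewrite /tens -linearP; apply/qpiP.
by apply: sub_lspan; right; exists a, u, v, v'.
Qed.

Lemma tens_ind (P : tensor -> Prop) :
  P 0 -> (forall u v x, P x -> P (tens u v + x)) -> forall x, P x.
Proof.
move=> P0 PD x; have [z ->] := qpi_surj x; elim/free_ind: z => [|a [u v] z IH].
  by rewrite linear0.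
have t0 : tens 0 v = 0.
  by have := tens_linl v (-1) 0 0; rewrite scaleN1r oppr0 addr0 scaleN1r addNr.
have tZ : a *: tens u v = tens (a *: u) v.
  by have := tens_linl v a u 0; rewrite t0 !addr0.
by have := PD (a *: u) v _ IH; rewrite -tZ /tens -linearP.
Qed.

Section Lift.
Variables (W : lmodType K) (b : U -> V -> W).

(* meaningful for bilinear b only *)
Definition tlift (x : tensor) : W := flift (fun p => b p.1 p.2) (repr x).

Hypotheses (bl : forall v, linear (b^~ v)) (br : forall u, linear (b u)).

Lemma tlift_qpi z : tlift (qpi _ z) = flift (fun p => b p.1 p.2) z.
Proof.
apply/eqP; rewrite /tlift -subr_eq0 -linearB; apply/eqP.
have: lspan tens_rel (repr (qpi tens_rel z) - z) by exact: repr_qpi.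
apply: (lspan_min (S' := [set w | flift (fun p => b p.1 p.2) w = 0])).
  split => [|a x y /= hx hy]; first exact: linear0.
  by rewrite linearP /= hx hy scaler0 addr0.
move=> _ [[a [u [u' [v ->]]]]|[a [u [v [v' ->]]]]] /=;
  rewrite linearB /= linearP /= !flift_delta /=.
  by have /= -> := bl v a u u'; rewrite subrr.
by rewrite br subrr.
Qed.

Lemma tlift_linear : linear tlift.
Proof.
move=> a x y; have [z ->] := qpi_surj x; have [w ->] := qpi_surj y.
by rewrite -linearP !tlift_qpi linearP.
Qed.

Lemma tlift_tens u v : tlift (tens u v) = b u v.
Proof. by rewrite tlift_qpi flift_delta. Qed.

End Lift.
End TensorProduct.

Section TensorMaps.
Variables (K : fieldType).
Implicit Types U V W : lmodType K.

Definition tmap U V U' V' (f : U -> U') (g : V -> V') :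
    tensor U V -> tensor U' V' :=
  tlift (fun u v => tens (f u) (g v)).

Definition tswap U V : tensor U V -> tensor V U := tlift (fun u v => tens v u).

Definition tassoc U V W : tensor (tensor U V) W -> tensor U (tensor V W) :=
  tlift (fun x w => tlift (fun u v => tens u (tens v w)) x).

Definition tmul U V (mU : U -> U -> U) (mV : V -> V -> V) (s t : tensor U V) :
    tensor U V :=
  tlift (fun a b => tmap (mU a) (mV b) t) s.

Lemma linear_0 U V (f : U -> V) : linear f -> f 0 = 0.
Proof.
by move=> h; have := h (-1) 0 0; rewrite scaleN1r oppr0 addr0 scaleN1r addNr.
Qed.

Lemma linear_D U V (f : U -> V) u v : linear f -> f (u + v) = f u + f v.
Proof. by move=> h; have := h 1 u v; rewrite !scale1r. Qed.

Lemma tmap_linear U V U' V' (f : U -> U') (g : V -> V') :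
  linear f -> linear g -> linear (tmap f g).
Proof.
move=> lf lg; apply: tlift_linear => [v|u] a x y /=.
  by rewrite lf tens_linl.
by rewrite lg tens_linr.
Qed.

Lemma tmap_tens U V U' V' (f : U -> U') (g : V -> V') u v :
  linear f -> linear g -> tmap f g (tens u v) = tens (f u) (g v).
Proof.
move=> lf lg; apply: tlift_tens => [w|w] a x y /=.
  by rewrite lf tens_linl.
by rewrite lg tens_linr.
Qed.

Lemma tens_ext U V W (f g : tensor U V -> W) : linear f -> linear g ->
  (forall u v, f (tens u v) = g (tens u v)) -> forall x, f x = g x.
Proof.
move=> lf lg h; elim/tens_ind => [|u v x IH]; first by rewrite !linear_0.
by rewrite (linear_D _ _ lf) (linear_D _ _ lg) h IH.
Qed.

Lemma tmap_linl U V U' V' (F : U -> U -> U') (g : V -> V') x :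
  (forall u, linear (F u)) -> (forall v, linear (F^~ v)) -> linear g ->
  linear (fun u => tmap (F u) g x).
Proof.
move=> Fr Fl lg a u u'; elim/tens_ind: x => [|w v x IH].
  by rewrite !(linear_0 (tmap_linear _ _)) // scaler0 addr0.
rewrite !(linear_D _ _ (tmap_linear _ _)) // IH !tmap_tens //.
have /= -> := Fl w a u u'.
by rewrite (tens_linl _ a) scalerDr addrACA.
Qed.

Lemma tmap_linr U V U' V' (f : U -> U') (G : V -> V -> V') x :
  (forall v, linear (G v)) -> (forall v, linear (G^~ v)) -> linear f ->
  linear (fun v => tmap f (G v) x).
Proof.
move=> Gr Gl lf a v v'; elim/tens_ind: x => [|u w x IH].
  by rewrite !(linear_0 (tmap_linear _ _)) // scaler0 addr0.
rewrite !(linear_D _ _ (tmap_linear _ _)) // IH !tmap_tens //.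
have /= -> := Gl w a v v'.
by rewrite (tens_linr _ a) scalerDr addrACA.
Qed.

End TensorMaps.

Section Hopf.
Variable K : fieldType.

Definition amul (A : algType K) : A -> A -> A := fun x y => x * y.
Definition mul2 (A : algType K) := tmul (@amul A) (@amul A).

Record hopf (A : algType K) := Hopf {
  comul : A -> tensor A A;
  counit : A -> K;
  antipode : A -> A;
  comul_linear : linear comul;
  counit_scalar : scalar counit;
  antipode_linear : linear antipode;
  comul1 : comul 1 = tens 1 1;
  comulM : forall a b, comul (a * b) = mul2 (comul a) (comul b);
  counit1 : counit 1 = 1;
  counitM : forall a b, counit (a * b) = counit a * counit b;
  comulA : forall a, tassoc (tmap comul id (comul a)) = tmap id comul (comul a);
  counitl : forall a, tlift (fun x y => counit x *: y) (comul a) = a;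
  counitr : forall a, tlift (fun x y => counit y *: x) (comul a) = a;
  antipodel : forall a,
    tlift (fun x y => antipode x * y) (comul a) = counit a *: 1;
  antipoder : forall a,
    tlift (fun x y => x * antipode y) (comul a) = counit a *: 1 }.

Record amod (A : algType K) := AMod {
  amod_sort :> lmodType K;
  act : A -> amod_sort -> amod_sort;
  act_linl : forall v, linear (act^~ v);
  act_linr : forall a, linear (act a);
  act1 : forall v, act 1 v = v;
  actM : forall a b v, act (a * b) v = act a (act b v) }.

Section Modules.
Variable A : algType K.
Implicit Types M N : amod A.

Definition ahom M N : set (M -> N) :=
  [set f | linear f /\ forall a x, f (act a x) = act a (f x)].

Definition aiso M N : Prop := exists2 f : M -> N, ahom f & bijective f.

Definition submodule M (S : set M) : Prop :=
  lsubspace S /\ forall a x, S x -> S (act a x).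

Definition irreducible M : Prop :=
  (exists x : M, x != 0) /\
  forall S : set M, submodule S -> S = [set 0] \/ S = setT.

Definition tact M N (t : tensor A A) (x : tensor M N) : tensor M N :=
  tlift (fun a b => tmap (act a) (act b) x) t.

Lemma tact_bil M N (x : tensor M N) :
  (forall b, linear ((fun a b => tmap (act a) (act b) x)^~ b)) /\
  (forall a, linear ((fun a b => tmap (act a) (act b) x) a)).
Proof.
split=> [b|a]; move=> c u u'; elim/tens_ind: x => [|m n x IH].
- by rewrite !(linear_0 (tmap_linear _ _)) ?scaler0 ?addr0 //; exact: act_linr.
- rewrite !(linear_D _ _ (tmap_linear _ _)); try exact: act_linr.
  rewrite IH !tmap_tens; try exact: act_linr.
  have /= -> := act_linl m c u u'.
  by rewrite (tens_linl _ c) scalerDr addrACA.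
- by rewrite !(linear_0 (tmap_linear _ _)) ?scaler0 ?addr0 //; exact: act_linr.
- rewrite !(linear_D _ _ (tmap_linear _ _)); try exact: act_linr.
  rewrite IH !tmap_tens; try exact: act_linr.
  have /= -> := act_linl n c u u'.
  by rewrite (tens_linr _ c) scalerDr addrACA.
Qed.

Lemma tact_linl M N (x : tensor M N) : linear (@tact M N ^~ x).
Proof. by have [? ?] := tact_bil x; apply: tlift_linear. Qed.

Lemma tact_tens M N a b (x : tensor M N) :
  tact (tens a b) x = tmap (act a) (act b) x.
Proof. by have [? ?] := tact_bil x; apply: tlift_tens. Qed.

Lemma tact_linr M N t : linear (@tact M N t).
Proof.
move=> c x y; elim/tens_ind: t => [|a b t IH].
  by rewrite !(linear_0 (tact_linl _)) scaler0 addr0.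
rewrite !(linear_D _ _ (tact_linl _)) IH !tact_tens.
rewrite (tmap_linear (act_linr a) (act_linr b)).
by rewrite scalerDr addrACA.
Qed.

Lemma amul_linl (b : A) : linear ((@amul A)^~ b).
Proof. by move=> c x y; rewrite /amul mulrDl scalerAl. Qed.

Lemma amul_linr (b : A) : linear (amul b).
Proof. by move=> c x y; rewrite /amul mulrDr scalerAr. Qed.

Lemma mul2_linl (t : tensor A A) : linear (@mul2 A ^~ t).
Proof.
apply: tlift_linear => [b|a].
  by apply: tmap_linl; [exact: amul_linr|exact: amul_linl|exact: amul_linr].
by apply: tmap_linr; [exact: amul_linr|exact: amul_linl|exact: amul_linr].
Qed.

Lemma mul2_tens a b (t : tensor A A) :
  mul2 (tens a b) t = tmap (amul a) (amul b) t.
Proof.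
apply: tlift_tens => [y|x].
  by apply: tmap_linl; [exact: amul_linr|exact: amul_linl|exact: amul_linr].
by apply: tmap_linr; [exact: amul_linr|exact: amul_linl|exact: amul_linr].
Qed.

Lemma mul2_tens2 (a b c d : A) :
  mul2 (tens a b) (tens c d) = tens (a * c) (b * d).
Proof. by rewrite mul2_tens tmap_tens //; exact: amul_linr. Qed.

Lemma mul2_linr (s : tensor A A) : linear (mul2 s).
Proof.
move=> c x y; elim/tens_ind: s => [|a b t IH].
  by rewrite !(linear_0 (mul2_linl _)) scaler0 addr0.
rewrite !(linear_D _ _ (mul2_linl _)) IH !mul2_tens.
rewrite (tmap_linear (@amul_linr a) (@amul_linr b)).
by rewrite scalerDr addrACA.
Qed.

Lemma tactM M N s t (x : tensor M N) : tact (mul2 s t) x = tact s (tact t x).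
Proof.
elim/tens_ind: s => [|a b s IH].
  by rewrite (linear_0 (mul2_linl _)) !(linear_0 (tact_linl _)).
rewrite (linear_D _ _ (mul2_linl _)) !(linear_D _ _ (tact_linl _)) IH.
congr (_ + _); elim/tens_ind: t {IH} => [|c d t IH].
  rewrite (linear_0 (mul2_linr _)) !(linear_0 (tact_linl _)).
  by rewrite (linear_0 (tact_linr _)).
rewrite (linear_D _ _ (mul2_linr _)) !(linear_D _ _ (tact_linl _)) IH.
rewrite (linear_D _ _ (tact_linr _)); congr (_ + _).
rewrite mul2_tens2; elim/tens_ind: x {IH} => [|m n x IH].
  by rewrite !(linear_0 (tact_linr _)).
rewrite !(linear_D _ _ (tact_linr _)) IH; congr (_ + _).
by rewrite !(tact_tens, tmap_tens) ?actM; try exact: act_linr.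
Qed.

Variable H : hopf A.

Lemma tensmod_act1 M N (x : tensor M N) : tact (comul H 1) x = x.
Proof.
rewrite comul1; elim/tens_ind: x => [|m n x IH].
  by rewrite (linear_0 (tact_linr _)).
rewrite (linear_D _ _ (tact_linr _)) IH tact_tens tmap_tens ?act1 //;
  exact: act_linr.
Qed.

Lemma tensmod_actM M N a b (x : tensor M N) :
  tact (comul H (a * b)) x = tact (comul H a) (tact (comul H b) x).
Proof. by rewrite comulM tactM. Qed.

Lemma tensmod_linl M N (x : tensor M N) : linear (fun a => tact (comul H a) x).
Proof. by move=> c a b; rewrite comul_linear tact_linl. Qed.

Definition tensmod M N : amod A :=
  @AMod A (tensor M N) (fun a => tact (comul H a)) (@tensmod_linl M N)
    (fun a => @tact_linr M N _) (@tensmod_act1 M N) (@tensmod_actM M N).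

Lemma trivmod_linl (v : K^o) : linear (fun a : A => counit H a *: v).
Proof. by move=> c a b; rewrite (counit_scalar H) scalerDl scalerA. Qed.
Lemma trivmod_linr (a : A) : linear (fun v : K^o => counit H a *: v).
Proof. by move=> c u v; rewrite scalerDr !scalerA mulrC. Qed.
Lemma trivmod_act1 (v : K^o) : counit H 1 *: v = v.
Proof. by rewrite counit1 scale1r. Qed.
Lemma trivmod_actM (a b : A) (v : K^o) :
  counit H (a * b) *: v = counit H a *: (counit H b *: v).
Proof. by rewrite counitM scalerA. Qed.

Definition trivmod : amod A :=
  @AMod A K^o (fun a v => counit H a *: v) trivmod_linl trivmod_linr
    trivmod_act1 trivmod_actM.

Lemma summod_linl M N (v : M * N) :
  linear (fun a : A => (act a v.1, act a v.2) : (M * N)%type).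
Proof. by move=> c a b; rewrite (act_linl v.1) (act_linl v.2). Qed.
Lemma summod_linr M N (a : A) :
  linear (fun v : M * N => (act a v.1, act a v.2) : (M * N)%type).
Proof. by move=> c u v /=; rewrite (act_linr a) (act_linr a). Qed.
Lemma summod_act1 M N (v : M * N) : (act 1 v.1, act 1 v.2) = v.
Proof. by rewrite !act1; case: v. Qed.
Lemma summod_actM M N a b (v : M * N) :
  (act (a * b) v.1, act (a * b) v.2) = (act a (act b v.1), act a (act b v.2)).
Proof. by rewrite !actM. Qed.

Definition summod M N : amod A :=
  @AMod A (M * N)%type (fun a v => (act a v.1, act a v.2)) (@summod_linl M N)
    (@summod_linr M N) (@summod_act1 M N) (@summod_actM M N).

End Modules.

Section CyclicModule.
Variables (A : algType K) (S : set A).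

Definition lideal : set A := [set x | exists y s, S s /\ x = y * s].
Definition cycact (a : A) (q : quotm lideal) : quotm lideal :=
  qpi lideal (a * repr q).

Lemma lidealM a x : lspan lideal x -> lspan lideal (a * x).
Proof.
apply: (lspan_min (S' := [set x | lspan lideal (a * x)])).
  have [h0 hD] := lspan_subspace lideal.
  by split => [|c u v hu hv] /=; rewrite ?mulr0 // mulrDr -scalerAr; apply: hD.
by move=> _ [y [s [Ss ->]]] /=; apply: sub_lspan; exists (a * y), s; rewrite mulrA.
Qed.

Lemma cycactE a x : cycact a (qpi _ x) = qpi _ (a * x).
Proof. by apply/qpiP; rewrite -mulrBr; apply: lidealM; exact: repr_qpi. Qed.

Lemma cycact_linl v : linear (cycact^~ v).
Proof.
move=> c a b; have [x ->] := qpi_surj v.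
by rewrite !cycactE -linearP mulrDl scalerAl.
Qed.
Lemma cycact_linr a : linear (cycact a).
Proof.
move=> c u v; have [x ->] := qpi_surj u; have [y ->] := qpi_surj v.
by rewrite -linearP !cycactE -linearP mulrDr scalerAr.
Qed.
Lemma cycact1 v : cycact 1 v = v.
Proof. by have [x ->] := qpi_surj v; rewrite cycactE mul1r. Qed.
Lemma cycactM a b v : cycact (a * b) v = cycact a (cycact b v).
Proof. by have [x ->] := qpi_surj v; rewrite !cycactE mulrA. Qed.

Definition cycmod : amod A :=
  @AMod A (quotm lideal) cycact cycact_linl cycact_linr cycact1 cycactM.

End CyclicModule.

End Hopf.

Section Polarized.
Variable K : fieldType.

Definition grading (V : lmodType K) (G : int -> set V) : Prop :=
  [/\ forall k, lsubspace (G k),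
      forall v, exists s : seq int, exists2 c : int -> V,
        (forall k, G k (c k)) & v = \sum_(k <- s) c k &
      forall (s : seq int) (c : int -> V), uniq s -> (forall k, G k (c k)) ->
        \sum_(k <- s) c k = 0 -> forall k, k \in s -> c k = 0].

Definition graded_subspace (V : lmodType K) (G : int -> set V) (B : set V) :=
  lsubspace B /\ forall v, B v -> exists s : seq int, exists2 c : int -> V,
    (forall k, (G k `&` B) (c k)) & v = \sum_(k <- s) c k.

Definition findim_subspace (V : lmodType K) (B : set V) : Prop :=
  exists s : seq V, B `<=` lspan [set` s].

Section Subsets.
Variable A : algType K.
Implicit Types B D : set A.

Definition subalgebra B : Prop :=
  [/\ lsubspace B, B 1 & forall x y, B x -> B y -> B (x * y)].

Definition prodset B D : set A :=
  lspan [set z | exists x y, [/\ B x, D y & z = x * y]].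

(* Over a field, B (x) D and B (x) D (x) F embed in A (x) A and
   (A (x) A) (x) A; these are the images. *)
Definition tens2 B D : set (tensor A A) :=
  lspan [set z | exists x y, [/\ B x, D y & z = tens x y]].
Definition tens3 B D F : set (tensor (tensor A A) A) :=
  lspan [set z | exists x y t, [/\ B x, D y, F t & z = tens (tens x y) t]].

Definition mulmap3 : tensor (tensor A A) A -> A :=
  tlift (fun s t => tlift (@amul K A) s * t).

Definition triangular B D F : Prop :=
  forall a, exists! z, tens3 B D F z /\ mulmap3 z = a.

Definition generated_by (s : seq A) : Prop :=
  forall B, subalgebra B -> [set` s] `<=` B -> B = setT.

Definition hopf_subalgebra (H : hopf A) B : Prop :=
  [/\ subalgebra B, forall b, B b -> tens2 B B (comul H b) &
      forall b, B b -> B (antipode H b)].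

End Subsets.

Record polarized := Polarized {
  palg :> algType K;
  phopf : hopf palg;
  pgr : int -> set palg;
  pgr_grading : grading pgr;
  pgr1 : pgr 0 1;
  pgrM : forall j k x y, pgr j x -> pgr k y -> pgr (j + k) (x * y);
  pgr_comul : forall k x, pgr k x ->
    lspan [set z | exists i j, i + j = k /\ tens2 (pgr i) (pgr j) z]
          (comul phopf x);
  pgr_counit : forall k x, k != 0 -> pgr k x -> counit phopf x = 0;
  pgr_antipode : forall k x, pgr k x -> pgr k (antipode phopf x);
  (* the subalgebra A_0 is the range of [pinj] *)
  palg0 : algType K;
  phopf0 : hopf palg0;
  pinj : palg0 -> palg;
  pinj_inj : injective pinj;
  pinj_linear : linear pinj;
  pinj1 : pinj 1 = 1;
  pinjM : forall x y, pinj (x * y) = pinj x * pinj y;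
  pinj_comul : forall x,
    comul phopf (pinj x) = tmap pinj pinj (comul phopf0 x);
  pinj_counit : forall x, counit phopf (pinj x) = counit phopf0 x;
  pinj_antipode : forall x,
    antipode phopf (pinj x) = pinj (antipode phopf0 x);
  palg0_comm : forall x y : palg0, x * y = y * x;
  palg0_cocomm : forall x, tswap (comul phopf0 x) = comul phopf0 x;
  palg0_fg : exists s : seq palg0, generated_by s;
  pinj_deg : range pinj `<=` pgr 0;
  pplus : set palg;
  pminus : set palg;
  pplus_subalg : subalgebra pplus;
  pminus_subalg : subalgebra pminus;
  pplus_graded : graded_subspace pgr pplus;
  pminus_graded : graded_subspace pgr pminus;
  pplus_findim : forall k, findim_subspace (pplus `&` pgr k);
  pminus_findim : forall k, findim_subspace (pminus `&` pgr k);
  pplus_deg : forall x, pplus x -> counit phopf x = 0 ->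
    lspan [set y | exists2 k, 0 < k & pgr k y] x;
  pminus_deg : forall x, pminus x -> counit phopf x = 0 ->
    lspan [set y | exists2 k, k < 0 & pgr k y] x;
  p_triangular : triangular pplus (range pinj) pminus;
  p_triangular' : triangular pminus (range pinj) pplus;
  p_ge0 : hopf_subalgebra phopf (prodset (range pinj) pplus);
  p_le0 : hopf_subalgebra phopf (prodset (range pinj) pminus) }.

Definition pge0 (A : polarized) : set A := prodset (range (@pinj A)) (@pplus A).
Definition ple0 (A : polarized) : set A := prodset (range (@pinj A)) (@pminus A).

End Polarized.

Section Characters.
Variables (K : fieldType) (A0 : algType K).

Record character := Character {
  chval :> A0 -> K;
  ch_scalar : scalar chval;
  ch1 : chval 1 = 1;
  chM : forall a b, chval (a * b) = chval a * chval b }.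

HB.instance Definition _ := gen_eqMixin character.
HB.instance Definition _ := gen_choiceMixin character.

Definition zclosed (Z : set character) : Prop :=
  exists S : set A0, Z = [set l | forall a, S a -> l a = 0].

Definition zconnected : Prop :=
  forall Y Z, zclosed Y -> zclosed Z -> Y `|` Z = setT -> Y `&` Z = set0 ->
    Y = set0 \/ Z = set0.

(* Spec of a Hopf algebra is equidimensional, so a closed subset has lower
   dimension iff it contains no irreducible component, i.e. iff it is nowhere
   dense in the Zariski topology. *)
Definition lower_dim (Z : set character) : Prop :=
  zclosed Z /\ forall Y, zclosed Y -> Z `|` Y = setT -> Y = setT.

Definition generic (P : set character) : Prop :=
  exists2 Z : nat -> set character, (forall n, lower_dim (Z n)) &
    ~` (\bigcup_n Z n) `<=` P.

Variable H0 : hopf A0.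
Implicit Types l m : character.

Definition chadd_fun l m : A0 -> K :=
  fun a => tlift (fun x y => l x * m y : K^o) (comul H0 a).

Lemma ch_bil l m :
  (forall y, linear ((fun x y => l x * m y : K^o)^~ y)) /\
  (forall x, linear ((fun x y => l x * m y : K^o) x)).
Proof.
split => [y|x] c u v /=.
  by rewrite (ch_scalar l) mulrDl -mulrA.
by rewrite (ch_scalar m) mulrDr mulrCA.
Qed.

Lemma chadd_scalar l m : scalar (chadd_fun l m).
Proof.
move=> c a b; rewrite /chadd_fun comul_linear.
by have [? ?] := ch_bil l m; rewrite tlift_linear.
Qed.

Lemma chadd1 l m : chadd_fun l m 1 = 1.
Proof.
rewrite /chadd_fun comul1; have [? ?] := ch_bil l m.
by rewrite tlift_tens // !ch1 mulr1.
Qed.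

Lemma chaddM l m a b : chadd_fun l m (a * b) = chadd_fun l m a * chadd_fun l m b.
Proof.
rewrite /chadd_fun comulM; have [hl hr] := ch_bil l m.
set F := tlift _; have lF : linear F by exact: tlift_linear.
have Ft x y : F (tens x y) = l x * m y by exact: tlift_tens.
elim/tens_ind: (comul H0 a) => [|x y s IH].
  by rewrite (linear_0 (mul2_linl _)) !(linear_0 lF) mul0r.
rewrite (linear_D _ _ (mul2_linl _)) !(linear_D _ _ lF) IH mulrDl.
congr (_ + _); elim/tens_ind: (comul H0 b) {IH} => [|u v t IH].
  by rewrite (linear_0 (mul2_linr _)) !(linear_0 lF) mulr0.
rewrite (linear_D _ _ (mul2_linr _)) !(linear_D _ _ lF) IH mulrDr.
by rewrite mul2_tens2 !Ft !chM mulrACA.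
Qed.

(* the group law of Spec A0, written additively *)
Definition chadd l m : character :=
  Character (chadd_scalar l m) (chadd1 l m) (@chaddM l m).

End Characters.

Section Meromorphic.
Variables (C : numFieldType) (A0 : algType C).
Local Notation T := (character A0).

(* Pointwise convergence of characters: for finitely generated A0 this is the
   classical topology induced by any closed embedding in an affine space. *)
HB.instance Definition _ := Topological.copy T
  (initial_topology (fun l : T => (l : prod_topology (fun _ : A0 => C^o)))).

Definition cheval n (a : 'I_n -> A0) (l : T) : 'rV[C]_n := \row_j l (a j).

(* Locally the restriction of a holomorphic function of several variables along
   a map to an affine space given by regular functions; F is differentiable over
   C near the point, hence holomorphic there. *)
Definition hol_at (f : T -> C^o) (x : T) : Prop :=
  exists n (a : 'I_n -> A0) (F : 'rV[C]_n -> C^o),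
    (\forall z \near cheval a x, differentiable F z) /\
    \forall y \near x, f y = F (cheval a y).

Definition meromorphic : {pred T -> C^o} := fun f =>
  `[< forall x : T, exists g h, (\forall y \near x, hol_at g y /\ hol_at h y) /\
        exists O : set T, [/\ open O, dense O &
          \forall y \near x, O y -> h y != 0 /\ f y = g y / h y] >].

Lemma hol_op (op : C -> C -> C) :
  (forall n (F G : 'rV[C]_n -> C^o) z, differentiable F z ->
     differentiable G z -> differentiable (fun w => op (F w) (G w) : C^o) z) ->
  forall f g x, hol_at f x -> hol_at g x ->
    hol_at (fun y => op (f y) (g y)) x.
Proof.
move=> dop f g x [n [a [F [dF fF]]]] [m [b [G [dG gG]]]].
pose ab (k : 'I_(n + m)) := match fintype.split k with inl i => a i | inr j => b j end.
have evl y : lsubmx (cheval ab y) = cheval a y.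
  by apply/rowP => j; rewrite !mxE /ab (unsplitK (inl j)).
have evr y : rsubmx (cheval ab y) = cheval b y.
  by apply/rowP => j; rewrite !mxE /ab (unsplitK (inr j)).
exists (n + m)%N, ab, (fun z => op (F (lsubmx z)) (G (rsubmx z))); split; last first.
  near=> y; rewrite evl evr; congr (op _ _); near: y; [exact: fF|exact: gG].
have cl : {for cheval ab x, continuous (lsubmx : 'rV[C]_(n + m) -> 'rV_n)}.
  exact/differentiable_continuous/differentiable_lsubmx.
have cr : {for cheval ab x, continuous (rsubmx : 'rV[C]_(n + m) -> 'rV_m)}.
  exact/differentiable_continuous/differentiable_rsubmx.
have nF : \forall z \near cheval ab x, differentiable F (lsubmx z).
  have h : nbhs (lsubmx (cheval ab x)) [set z | differentiable F z].
    by rewrite evl; exact: dF.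
  exact: (cl _ h).
have nG : \forall z \near cheval ab x, differentiable G (rsubmx z).
  have h : nbhs (rsubmx (cheval ab x)) [set z | differentiable G z].
    by rewrite evr; exact: dG.
  exact: (cr _ h).
near=> z; apply: (dop _ (F \o lsubmx) (G \o rsubmx)).
- apply: differentiable_comp; first exact: differentiable_lsubmx.
  by near: z.
- apply: differentiable_comp; first exact: differentiable_rsubmx.
  by near: z.
Unshelve. all: by end_near. Qed.

Lemma holD f g x : hol_at f x -> hol_at g x -> hol_at (fun y => f y + g y) x.
Proof. by apply: hol_op => n F G z; exact: differentiableD. Qed.

Lemma holM f g x : hol_at f x -> hol_at g x -> hol_at (fun y => f y * g y) x.
Proof. by apply: hol_op => n F G z; exact: (@differentiableM C). Qed.

Lemma hol_cst (c : C) x : hol_at (fun=> c) x.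
Proof.
exists 0%N, (fun _ => 0), (fun=> c); split; first by near=> z; exact: differentiable_cst.
by near=> y.
Unshelve. all: by end_near. Qed.

Lemma meromorphic_cst (c : C) : (fun=> c) \in meromorphic.
Proof.
apply/asboolP => x; exists (fun=> c), (fun=> 1); split.
  by near=> y; split; exact: hol_cst.
exists setT; split; [exact: openT|by move=> O O0 _; rewrite setIT|].
by near=> y => _; rewrite oner_neq0 divr1.
Unshelve. all: by end_near. Qed.

Lemma meromorphicD f g :
  f \in meromorphic -> g \in meromorphic -> (fun y => f y + g y) \in meromorphic.
Proof.
move=> /asboolP mf /asboolP mg; apply/asboolP => x.
have [p [q [hpq [O [oO dO fpq]]]]] := mf x.
have [r [s [hrs [Q [oQ dQ grs]]]]] := mg x.
exists (fun y => p y * s y + r y * q y), (fun y => q y * s y); split.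
  near=> y.
  have [hp hq] : hol_at p y /\ hol_at q y by near: y.
  have [hr hs] : hol_at r y /\ hol_at s y by near: y.
  by split; [apply: holD; apply: holM|apply: holM].
exists (O `&` Q); split; [exact: openI|exact: denseI|].
near=> y => -[Oy Qy].
have [q0 ->] : q y != 0 /\ f y = p y / q y by move: Oy; near: y.
have [s0 ->] : s y != 0 /\ g y = r y / s y by move: Qy; near: y.
by rewrite mulf_neq0 // addf_div.
Unshelve. all: by end_near. Qed.

Lemma meromorphicM f g :
  f \in meromorphic -> g \in meromorphic -> (fun y => f y * g y) \in meromorphic.
Proof.
move=> /asboolP mf /asboolP mg; apply/asboolP => x.
have [p [q [hpq [O [oO dO fpq]]]]] := mf x.
have [r [s [hrs [Q [oQ dQ grs]]]]] := mg x.
exists (fun y => p y * r y), (fun y => q y * s y); split.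
  near=> y.
  have [hp hq] : hol_at p y /\ hol_at q y by near: y.
  have [hr hs] : hol_at r y /\ hol_at s y by near: y.
  by split; apply: holM.
exists (O `&` Q); split; [exact: openI|exact: denseI|].
near=> y => -[Oy Qy].
have [q0 ->] : q y != 0 /\ f y = p y / q y by move: Oy; near: y.
have [s0 ->] : s y != 0 /\ g y = r y / s y by move: Qy; near: y.
by rewrite mulf_neq0 // mulf_div.
Unshelve. all: by end_near. Qed.

Lemma meromorphic_submod : submod_closed meromorphic.
Proof.
split; first exact: meromorphic_cst.
move=> a f g mf mg; apply: (@meromorphicD (fun y => a * f y)) => //.
by apply: meromorphicM => //; exact: meromorphic_cst.
Qed.

HB.instance Definition _ := GRing.isSubmodClosed.Build C (T -> C^o) meromorphic
  meromorphic_submod.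
HB.instance Definition _ := GRing.isMul2Closed.Build (T -> C^o) meromorphic
  meromorphicM.
HB.instance Definition _ := GRing.isMul1Closed.Build (T -> C^o) meromorphic
  (meromorphic_cst 1).

Record mfun := MFun { mfval :> T -> C^o; _ : mfval \in meromorphic }.
HB.instance Definition _ := [isSub for mfval].
HB.instance Definition _ := [Choice of mfun by <:].
HB.instance Definition _ := [SubChoice_isSubLmodule of mfun by <:].
HB.instance Definition _ := GRing.SubZmodule_isSubPzRing.Build _ _ mfun
  (subringClosedP _).
HB.instance Definition _ := GRing.SubPzRing_isSubComPzRing.Build _ _ mfun.

Definition mnegl : set mfun :=
  [set f | exists O : set T, [/\ open O, dense O & forall x, O x -> f x = 0]].

Lemma mnegl_subspace : lsubspace mnegl.
Proof.
split; first by exists setT; split => //; [exact: openT|move=> O ? _; rewrite setIT].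
move=> a f g [O [oO dO fO]] [Q [oQ dQ gQ]]; exists (O `&` Q).
split; [exact: openI|exact: denseI|] => x [Ox Qx].
rewrite (_ : (a *: f + g) x = a * f x + g x) // fO // gQ //.
by rewrite mulr0 addr0.
Qed.

Lemma mneglM f g : mnegl f -> mnegl (g * f).
Proof.
move=> [O [oO dO fO]]; exists O; split => // x Ox.
by rewrite (_ : (g * f) x = g x * f x) // fO // mulr0.
Qed.

(* The values of a representative on a nowhere dense set are irrelevant, so M_T
   consists of classes modulo agreement on a dense open set. *)
Definition merof := quotm mnegl.
HB.instance Definition _ := GRing.Lmodule.on merof.

Definition meroclass (f : mfun) : merof := qpi mnegl f.
Definition mmul (p q : merof) : merof := meroclass (repr p * repr q).

Lemma meroclassP f g : meroclass f = meroclass g <-> mnegl (f - g).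
Proof.
split=> [/qpiP|h]; first exact: (lspan_min mnegl_subspace (@subset_refl _ _)).
by apply/qpiP; exact: sub_lspan.
Qed.

Lemma mmulE f g : mmul (meroclass f) (meroclass g) = meroclass (f * g).
Proof.
apply/meroclassP; set f' := repr _; set g' := repr _.
have hf : mnegl (f' - f) by apply/meroclassP; exact: qpi_repr.
have hg : mnegl (g' - g) by apply/meroclassP; exact: qpi_repr.
have -> : f' * g' - f * g = 1 *: (g' * (f' - f)) + f * (g' - g).
  by rewrite scale1r !mulrBr (mulrC g') (mulrC g' f) addrA subrK.
by apply: mnegl_subspace.2; exact: mneglM.
Qed.

Lemma meroclass_surj p : exists f, p = meroclass f.
Proof. exact: qpi_surj. Qed.

Lemma meroclassD f g : meroclass (f + g) = meroclass f + meroclass g.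
Proof. by rewrite /meroclass linearD. Qed.

Lemma mmulA : associative mmul.
Proof.
move=> p q r; have [x ->] := meroclass_surj p; have [y ->] := meroclass_surj q.
by have [z ->] := meroclass_surj r; rewrite !mmulE mulrA.
Qed.
Lemma mmulC : commutative mmul.
Proof.
move=> p q; have [x ->] := meroclass_surj p; have [y ->] := meroclass_surj q.
by rewrite !mmulE mulrC.
Qed.
Lemma mmul1 : left_id (meroclass 1) mmul.
Proof. by move=> p; have [x ->] := meroclass_surj p; rewrite mmulE mul1r. Qed.
Lemma mmulDl : left_distributive mmul +%R.
Proof.
move=> p q r; have [x ->] := meroclass_surj p; have [y ->] := meroclass_surj q.
by have [z ->] := meroclass_surj r; rewrite -meroclassD !mmulE mulrDl meroclassD.
Qed.
Lemma mmulr1 : right_id (meroclass 1) mmul.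
Proof. by move=> p; rewrite mmulC mmul1. Qed.
Lemma mmulDr : right_distributive mmul +%R.
Proof. by move=> p q r; rewrite mmulC mmulDl !(mmulC _ p). Qed.

HB.instance Definition _ := GRing.Zmodule_isPzRing.Build merof
  mmulA mmul1 mmulr1 mmulDl mmulDr.
HB.instance Definition _ := GRing.PzRing_hasCommutativeMul.Build merof mmulC.

End Meromorphic.

Section Verma.
Variables (C : numFieldType) (A : polarized C).
Local Notation T := (character (palg0 A)).

Definition weight (M : amod A) (l : T) : set M :=
  [set x | forall a, act (pinj a) x = l a *: x].

(* A (x)_B chi for B spanned by the products a b with a in A_0, b in D is the
   quotient of A by the left ideal generated by the elements a b - chi(a b). *)
Definition verma_rel (D : set A) (l : T) : set A :=
  [set x | exists a b, D b /\ x = pinj a * b - (l a * counit (phopf A) b) *: 1].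
Definition verma_mod (D : set A) (l : T) : amod A := cycmod (verma_rel D l).
Definition verma := verma_mod (@pplus _ A).
Definition vermam := verma_mod (@pminus _ A).

Definition vac (l : T) : verma l := qpi (lideal (verma_rel (@pplus _ A) l)) 1.

(* the degree-zero functional v_l^* on M_l^+ *)
Definition vac_dual (l : T) (xi : verma l -> C) : Prop :=
  [/\ scalar xi, xi (vac l) = 1 &
      forall k a, k != 0 -> pgr k a -> xi (act a (vac l)) = 0].

Definition nondegenerate_polarized : Prop :=
  generic (fun l : T => irreducible (verma l)) /\
  generic (fun l : T => irreducible (vermam l)).

(* objects of the category O; its morphisms are all A-linear maps *)
Record modO := ModO {
  omod :> amod A;
  ogr : int -> set omod;
  ogr_grading : grading ogr;
  ogr_act : forall j k a x, pgr j a -> ogr k x -> ogr (j + k) (act a x);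
  ogr_bounded : exists N, forall k, N < k -> ogr k = [set 0];
  ogr_diag : forall x, lspan [set y | exists l, @weight omod l y] x }.

Record semisimple_tensor_subcategory (O0 : modO -> Prop) : Prop := {
  O0_findim : forall X, O0 X -> findim_subspace [set: X];
  O0_zero : exists2 Z, O0 Z & forall x : Z, x = 0;
  O0_sum : forall X Y, O0 X -> O0 Y -> exists2 Z, O0 Z & aiso Z (summod X Y);
  O0_ker : forall (X Y : modO) (f : X -> Y), O0 X -> O0 Y -> ahom f ->
    exists (Z : modO) (i : Z -> X), [/\ O0 Z, ahom i, injective i &
                              range i = [set x | f x = 0]];
  O0_coker : forall (X Y : modO) (f : X -> Y), O0 X -> O0 Y -> ahom f ->
    exists (Z : modO) (p : Y -> Z), [/\ O0 Z, ahom p, range p = setT &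
                              [set y | p y = 0] = range f];
  O0_unit : exists2 Z, O0 Z & aiso Z (trivmod (phopf A));
  O0_tens : forall X Y, O0 X -> O0 Y ->
    exists2 Z, O0 Z & aiso Z (tensmod (phopf A) X Y);
  O0_semisimple : forall X, O0 X ->
    exists n (S : 'I_n -> modO) (i : forall k, S k -> X),
      (forall k, [/\ O0 (S k), irreducible (S k) & ahom (i k)]) /\
      forall x, exists! c : (forall k, S k), x = \sum_k i k (c k) }.

Record hbasis (X : modO) := HBasis {
  hdim : nat;
  hvec : 'I_hdim -> X;
  hco : 'I_hdim -> X -> C;
  hco_scalar : forall i, scalar (hco i);
  hco_vec : forall i j, hco i (hvec j) = (i == j)%:R;
  hvec_span : forall x, x = \sum_i hco i x *: hvec i;
  hwt : 'I_hdim -> T;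
  hvec_weight : forall i, weight (hwt i) (hvec i);
  hvec_deg : forall i, exists k, ogr k (hvec i) }.

(* Ir, by representatives with chosen bases; [ir_e] is the index of the basis
   vector e of the representative of the trivial module *)
Record irreps (O0 : modO -> Prop) := Irreps {
  ir_ix :> choiceType;
  ir_mod : ir_ix -> modO;
  ir_in : forall U, O0 (ir_mod U);
  ir_irr : forall U, irreducible (ir_mod U);
  ir_inj : forall U U', aiso (ir_mod U) (ir_mod U') -> U = U';
  ir_all : forall X, O0 X -> irreducible X -> exists U, aiso X (ir_mod U);
  ir_basis : forall U, hbasis (ir_mod U);
  ir_triv : ir_ix;
  ir_triv_act : forall a (x : ir_mod ir_triv), act a x = counit (phopf A) a *: x;
  ir_e : 'I_(hdim (ir_basis ir_triv)) }.

(* elements of End(W) (x) End(V) (x) S: X i j k l is the coefficient of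
   E_ij (x) E_kl *)
Definition op4 (S : Type) m n := 'I_m -> 'I_m -> 'I_n -> 'I_n -> S.
Definition op4_mul (S : pzRingType) m n (X Y : op4 S m n) : op4 S m n :=
  fun i j k l => \sum_p \sum_q X i p k q * Y p j q l.
Definition op4_one (S : pzRingType) m n : op4 S m n :=
  fun i j k l => ((i == j) && (k == l))%:R.
Definition op4_flip S m n (X : op4 S m n) : op4 S n m :=
  fun k l i j => X i j k l.

Definition tcoord (X Y : modO) (bX : hbasis X) (bY : hbasis Y)
    (i : 'I_(hdim bX)) (k : 'I_(hdim bY)) : tensor X Y -> C^o :=
  tlift (fun x y => hco i x * hco k y : C^o).

Definition op4_of (X Y : modO) (bX : hbasis X) (bY : hbasis Y)
    (F : tensor X Y -> tensor X Y) : op4 C (hdim bX) (hdim bY) :=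
  fun i j k l => tcoord i k (F (tens (hvec j) (hvec l))).

Section Quasitriangular.
Local Notation AA := (tensor A A).
Local Notation AAA := (tensor (tensor A A) A).
Local Notation Delta := (comul (phopf A)).

Definition idealI (n : nat) : set A :=
  lspan [set z | exists y x, (exists2 j : int, n%:Z <= j & pgr j x) /\ z = y * x].

(* kernels of A (x) A -> A/I_n (x) A/I_n and its three-fold analogue *)
Definition idealI2 n : set AA :=
  lspan [set z | exists a b, (idealI n a \/ idealI n b) /\ z = tens a b].
Definition idealI3 n : set AAA :=
  lspan [set z | exists a b c, [\/ idealI n a, idealI n b | idealI n c] /\
                               z = tens (tens a b) c].

(* An element of the completed tensor square is a compatible sequence of
   classes in A/I_n (x) A/I_n, given by representatives [hseq n]; the limit is
   taken in each degree, so only finitely many degrees occur. *)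
Record ctens := CTens {
  hseq :> nat -> AA;
  hseq_compat : forall n m, (n <= m)%N -> idealI2 n (hseq m - hseq n);
  hseq_deg : exists d : nat, forall n, exists2 z,
    lspan [set y | exists i j : int,
             `|i + j| <= d%:Z /\ tens2 (@pgr _ A i) (@pgr _ A j) y] z &
    idealI2 n (hseq n - z) }.

Definition mul3 : AAA -> AAA -> AAA := tmul (@mul2 _ A) (@amul _ A).
Definition leg12 : AA -> AAA := fun t => tens t 1.
Definition leg13 : AA -> AAA := tlift (fun a b => tens (tens a 1) b).
Definition leg23 : AA -> AAA := tlift (fun a b => tens (tens 1 a) b).
Definition Delta_id : AA -> AAA := tmap Delta id.
Definition id_Delta : AA -> AAA :=
  tlift (fun a t => tlift (fun b c => tens (tens a b) c) t) \o tmap id Delta.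

(* In a product of two elements x, y of a completion, the class modulo I_n is
   obtained by first approximating y, and then x to a precision that may depend
   on the approximation of y, since I_n is only a left ideal. *)
Record quasitriangular (r : ctens) : Prop := {
  qt_inv : exists r' : ctens,
    (forall n, \forall m' \near \oo, \forall m \near \oo,
       idealI2 n (mul2 (r m) (r' m') - tens 1 1)) /\
    (forall n, \forall m' \near \oo, \forall m \near \oo,
       idealI2 n (mul2 (r' m) (r m') - tens 1 1));
  qt_comul : forall a n, \forall m \near \oo,
    idealI2 n (mul2 (r m) (Delta a) - mul2 (tswap (Delta a)) (r m));
  qt_hexl : forall n, \forall m' \near \oo, \forall m \near \oo,
    idealI3 n (Delta_id (r m) - mul3 (leg13 (r m)) (leg23 (r m')));
  qt_hexr : forall n, \forall m' \near \oo, \forall m \near \oo,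
    idealI3 n (id_Delta (r m) - mul3 (leg13 (r m)) (leg12 (r m'))) }.

(* r lies in the completed tensor product of A_{>=0} and A_{<=0} *)
Definition upper_lower (r : ctens) : Prop :=
  forall n, exists2 z, tens2 (@pge0 _ A) (@ple0 _ A) z & idealI2 n (r n - z).

(* the action of r^21 on X (x) Y: the matrix elements of r_n^21 are eventually
   constant in n for X and Y finite dimensional *)
Definition flip_act (r : ctens) (X Y : modO) (bX : hbasis X) (bY : hbasis Y) :
    op4 C (hdim bX) (hdim bY) :=
  fun i j k l => xget 0 [set c | \forall n \near \oo,
    op4_of (bX := bX) (bY := bY) (tact (tswap (r n))) i j k l = c].

End Quasitriangular.

Section Fusion.
Local Notation H := (phopf A).
Local Notation MT := (merof (palg0 A)).

(* For l = lambda, m = lambda - lambda_v and x = v, F is Phi^v_lambda. The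
   weights are related in [fusion_at] by m + lambda_v = l. *)
Definition intertwiner (l m : T) (X : amod A) (x : X)
    (F : verma l -> tensmod H (verma m) X) : Prop :=
  ahom F /\ exists2 xi, vac_dual xi &
    tlift (fun (y : verma m) (z : X) => xi y *: z) (F (vac l)) = x.

Definition Phi (l m : T) (X : amod A) (x : X)
    (F : verma l -> tensmod H (verma m) X) : Prop :=
  intertwiner x F /\ forall G, intertwiner x G -> G = F.

Definition fusion_at (l : T) (W V : modO) (bW : hbasis W) (bV : hbasis V)
    (J : op4 C (hdim bW) (hdim bV)) : Prop :=
  forall (j : 'I_(hdim bW)) (j' : 'I_(hdim bV)) m m',
    chadd (phopf0 A) m (hwt j') = l -> chadd (phopf0 A) m' (hwt j) = m ->
    exists F G, [/\ @Phi l m V (hvec j') F, @Phi m m' W (hvec j) G &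
      @Phi l m' (tensmod H W V)
        (\sum_i \sum_i' J i j i' j' *: tens (hvec i) (hvec i'))
        (fun x => tassoc (tmap G id (F x)))].

Definition represents (F : MT) (f : T -> C) : Prop :=
  exists2 g : mfun (palg0 A), F = meroclass g & forall l, g l = f l.

(* J is J_{W,V} as a matrix over M_T, and Ji is its inverse. The values of J are
   prescribed for generic lambda only, through functions representing the
   entries of J. *)
Record fusion_matrix (W V : modO) (bW : hbasis W) (bV : hbasis V)
    (J Ji : op4 MT (hdim bW) (hdim bV)) : Prop := {
  fusion_value : exists2 j : T -> op4 C (hdim bW) (hdim bV),
    (forall i i' k k', represents (J i i' k k') (fun l => j l i i' k k')) &
    generic (fun l => fusion_at l (j l));
  fusion_invl : op4_mul Ji J = @op4_one MT _ _;
  fusion_invr : op4_mul J Ji = @op4_one MT _ _ }.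

End Fusion.

Section HomSpace.
Variables M N : amod A.

Definition is_ahom : {pred M -> N} := fun f => `[< ahom f >].

Lemma is_ahom_closed : submod_closed is_ahom.
Proof.
split.
  apply/asboolP; split => [c u v|a x] /=; first by rewrite scaler0 addr0.
  by rewrite (linear_0 (act_linr _)).
move=> c f g /asboolP[lf hf] /asboolP[lg hg]; apply/asboolP.
have E x : (c *: f + g) x = c *: f x + g x by [].
split => [d u v|a x]; rewrite !E.
  by rewrite lf lg !scalerDr !scalerA (mulrC c d) addrACA.
by rewrite hf hg act_linr.
Qed.

HB.instance Definition _ := GRing.isSubmodClosed.Build C (M -> N) is_ahom
  is_ahom_closed.

Record homA := HomA { homfun :> M -> N; _ : homfun \in is_ahom }.
HB.instance Definition _ := [isSub for homfun].
HB.instance Definition _ := [Choice of homA by <:].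
HB.instance Definition _ := [SubChoice_isSubLmodule of homA by <:].

Definition tau : tensor homA M -> N := tlift (fun (h : homA) x => h x).

End HomSpace.

Section ExchangeAlgebra.
Variables (O0 : modO -> Prop) (Ir : irreps O0).
Local Notation MT := (merof (palg0 A)).
Local Notation md := (@ir_mod _ Ir).
Local Notation bs := (@ir_basis _ Ir).
Local Notation dim U := (hdim (bs U)).
Local Notation WV W V := (tensmod (phopf A) (md W) (md V)).

Definition taubar_type := forall W V U : Ir,
  WV W V -> tensor (homA (md U) (WV W V)) (md U).

(* taubar W V U is the projection onto the isotypic component of U along the
   other ones, followed by the inverse of tau *)
Definition is_taubar (tb : taubar_type) : Prop := forall W V,
  [/\ forall U, linear (tb W V U),
      forall U y, tb W V U (tau y) = y &
      forall U U' (y : tensor (homA (md U') (WV W V)) (md U')),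
        U' <> U -> tb W V U (tau y) = 0].

(* matrix of tau (Id (x) E_pq) taubar, the coefficient of L^U_pq in
   tau (Id (x) L^U) taubar *)
Definition iso_coef (tb : taubar_type) (W V U : Ir) (p q : 'I_(dim U)) :
    op4 C (dim W) (dim V) :=
  op4_of (bX := bs W) (bY := bs V) (fun x =>
    tau (tmap id (fun u => hco q u *: hvec p) (tb W V U x))).

(* (+)_U U (x) U^*, in the basis of the v_i (x) v_j^* *)
Definition exch_bar := free C {U : Ir & ('I_(dim U) * 'I_(dim U))%type}.
Definition exch := tensor (tensor MT MT) exch_bar.

Definition exelt (f g : MT) (U : Ir) (i j : 'I_(dim U)) : exch :=
  tens (tens f g) (fdelta C (existT _ U (i, j))).
Definition exL (U : Ir) (i j : 'I_(dim U)) : exch := exelt 1 1 i j.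
Definition exfun1 (f : MT) : exch := exelt f 1 (ir_e Ir) (ir_e Ir).
Definition exfun2 (g : MT) : exch := exelt 1 g (ir_e Ir) (ir_e Ir).

(* f' is the function l |-> f(l + w) *)
Definition translate (w : T) (f f' : MT) : Prop :=
  exists F F' : mfun (palg0 A), [/\ f = meroclass F, f' = meroclass F' &
    forall l, F' l = F (chadd (phopf0 A) l w)].

Definition op4_family := forall W V : Ir, op4 MT (dim W) (dim V).

(* The product on E is characterized by its defining relations; normal ordering
   in the last one means that the functions of lambda^1 and lambda^2 form the
   first two tensor factors of [exelt]. *)
Record exchange_product (J Ji : op4_family) (tb : taubar_type)
    (mul : exch -> exch -> exch) : Prop := {
  ex_linl : forall y, linear (mul^~ y);
  ex_linr : forall x, linear (mul x);
  ex_assoc : associative mul;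
  ex_fun11 : forall f g, mul (exfun1 f) (exfun1 g) = exfun1 (f * g);
  ex_fun22 : forall f g, mul (exfun2 f) (exfun2 g) = exfun2 (f * g);
  ex_fun12 : forall f g, mul (exfun1 f) (exfun2 g) = mul (exfun2 g) (exfun1 f);
  ex_elt : forall f g U (i j : 'I_(dim U)),
    mul (exfun1 f) (mul (exfun2 g) (exL i j)) = exelt f g i j;
  ex_shift1 : forall f f' U (i j : 'I_(dim U)), translate (hwt i) f f' ->
    mul (exfun1 f) (exL i j) = mul (exL i j) (exfun1 f');
  ex_shift2 : forall f f' U (i j : 'I_(dim U)), translate (hwt j) f f' ->
    mul (exfun2 f) (exL i j) = mul (exL i j) (exfun2 f');
  (* the coefficient of E^W_kl (x) E^V_ij in the formula for L^V L^W *)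
  ex_LL : forall (V W : Ir) (i j : 'I_(dim V)) (k l : 'I_(dim W)),
    mul (exL i j) (exL k l) =
    \sum_(U \in [set: Ir]) \sum_(p < dim U) \sum_(q < dim U)
      \sum_a \sum_b \sum_c \sum_d
        iso_coef tb (W := W) (V := V) p q a c b d *:
          exelt (Ji W V k a i b) (J W V c l d j) p q }.

Definition exchange_matrix (J Ji : op4_family) (r : ctens) (V W : Ir) :
    op4 MT (dim V) (dim W) :=
  op4_mul (op4_mul (Ji V W) (fun i j k l =>
      flip_act r (bX := bs V) (bY := bs W) i j k l *: (1 : MT)))
    (op4_flip (J W V)).

End ExchangeAlgebra.
End Verma.

Arguments exchange_matrix {C A O0 Ir} J Ji r V W _ _ _ _.
Arguments exfun1 {C A O0 Ir} f.
Arguments exfun2 {C A O0 Ir} g.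

(* Main.v *)
Require Import Defs.
From HB Require Import structures.
From mathcomp Require Import all_boot all_order all_algebra complex.
From mathcomp Require Import finmap topology.
From mathcomp Require Import all_classical all_reals.

(* Let K_{W,V} denote the sum of the tau_U (Id (x) L^U) taubar_U on W (x) V, so
   that the product of L^V and L^W is : J_{W,V}(lambda^1)^{-1} K_{W,V}
   J_{W,V}(lambda^2) :. The map R^21 P : W (x) V -> V (x) W commutes with A, and
   the projections on isotypic components are natural, hence
   R^21 K_{W,V}^21 = K_{V,W} R^21. After cancelling J against its inverse, the
   left-hand side is : J_{V,W}(lambda^1)^{-1} R^21 K_{W,V}^21
   J_{W,V}^21(lambda^2) : and the right-hand side is
   : J_{V,W}(lambda^1)^{-1} K_{V,W} R^21 J_{W,V}^21(lambda^2) :. *)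

Set Implicit Arguments.
Unset Strict Implicit.
Unset Printing Implicit Defensive.

Import Order.TTheory GRing.Theory Num.Theory.
Local Open Scope classical_set_scope.
Local Open Scope ring_scope.

(** * Maps given with a proof of linearity *)

Section LinearMaps.
Variable K : fieldType.

Lemma linear_sum (U V : lmodType K) (f : U -> V) (I : Type) (s : seq I) (F : I -> U) :
  linear f -> f (\sum_(i <- s) F i) = \sum_(i <- s) f (F i).
Proof.
move=> lf; elim/big_rec2: _ => [|i y x _ <-]; first exact: linear_0.
exact: linear_D.
Qed.

Lemma linear_Z (U V : lmodType K) (f : U -> V) (a : K) (u : U) :
  linear f -> f (a *: u) = a *: f u.
Proof. by move=> lf; have := lf a u 0; rewrite (linear_0 lf) !addr0. Qed.

Lemma comp_linear (U V W : lmodType K) (g : V -> W) (f : U -> V) :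
  linear g -> linear f -> linear (fun x => g (f x)).
Proof. by move=> lg lf a x y; rewrite lf lg. Qed.

End LinearMaps.

(** * The permutation of tensor factors and its compatibility with products and actions *)

Section TensorSwap.
Variable K : fieldType.

Lemma tswap_linear (U V : lmodType K) : linear (@tswap K U V).
Proof. by apply: tlift_linear => [v|u] a x y; rewrite ?tens_linl ?tens_linr. Qed.

Lemma tswap_tens (U V : lmodType K) (u : U) (v : V) : tswap (tens u v) = tens v u.
Proof. by apply: tlift_tens => [w|w] a x y; rewrite ?tens_linl ?tens_linr. Qed.

Lemma tswapK (U V : lmodType K) (x : tensor U V) : tswap (tswap x) = x.
Proof.
move: x; apply: tens_ext => [|//|u v]; last by rewrite !tswap_tens.
by apply: comp_linear; exact: tswap_linear.
Qed.

Variable A : algType K.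

Lemma tswap_mul2 (s t : tensor A A) :
  tswap (mul2 s t) = mul2 (tswap s) (tswap t).
Proof.
move: s; apply: tens_ext => [||a b].
- by apply: comp_linear; [exact: tswap_linear|exact: mul2_linl].
- by apply: (comp_linear (mul2_linl _)); exact: tswap_linear.
move: t; apply: tens_ext => [||c d].
- by apply: comp_linear; [exact: tswap_linear|exact: mul2_linr].
- by apply: (comp_linear (mul2_linr _)); exact: tswap_linear.
by rewrite !(mul2_tens2, tswap_tens).
Qed.

Lemma tswap_tact (M N : amod A) (t : tensor A A) (x : tensor M N) :
  tswap (tact t x) = tact (tswap t) (tswap x).
Proof.
move: t; apply: tens_ext => [||a b].
- by apply: comp_linear; [exact: tswap_linear|exact: tact_linl].
- by apply: (comp_linear (@tact_linl _ _ _ _ _)); exact: tswap_linear.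
move: x; apply: tens_ext => [||m n].
- by apply: comp_linear; [exact: tswap_linear|exact: tact_linr].
- by apply: (comp_linear (@tact_linr _ _ _ _ _)); exact: tswap_linear.
rewrite !(tswap_tens, tact_tens) !tmap_tens ?tswap_tens //; exact: act_linr.
Qed.

End TensorSwap.

(** * The action of R^21 on finite dimensional modules and the braiding R^21 P *)

Section Braiding.
Variables (C : numFieldType) (A : polarized C).

(** The finitely many basis vectors have degrees bounded below, while [ogr_bounded] bounds the
    degrees of [X] above: a factor of large degree sends every basis vector beyond the top degree.
    [idealI n] is spanned by left multiples of such factors. *)
Lemma idealI_act0 (X : modO A) (bX : hbasis X) : exists N : nat, forall n a,
  (N <= n)%N -> idealI n a -> forall x : X, act a x = 0.
Proof.
have [N0 hN0] := ogr_bounded X.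
have [d hd] := fin_all_exists (@hvec_deg _ _ _ bX).
(* This sum exceeds every [N0 - d i], so [n <= j] forces [N0 < j + d i]. *)
exists (\sum_i `|N0 - d i|.+1)%N => n a hn.
suff h : idealI n `<=` [set a | forall x : X, act a x = 0] by move=> /h.
apply: lspan_min.
  split=> [x|c a1 a2 h1 h2 x] /=; first by rewrite (linear_0 (act_linl x)).
  by rewrite act_linl h1 h2 scaler0 addr0.
move=> _ [y [z [[j nj zj] ->]]] x; rewrite actM.
suff -> : act z x = 0 by rewrite (linear_0 (act_linr y)).
rewrite (hvec_span bX x).
elim/big_rec: _ => [|i u _ IH]; first by rewrite (linear_0 (act_linr z)).
rewrite act_linr IH addr0.
have : ogr (j + d i) (act z (hvec i)) by apply: ogr_act.
rewrite hN0; first by move=> ->; rewrite scaler0.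
have h1 : (`|N0 - d i|.+1 <= n)%N.
  apply: leq_trans hn; rewrite (bigD1 i) //=; exact: leq_addr.
rewrite -ltrBlDr; apply: lt_le_trans nj; apply: le_lt_trans (ler_norm _) _.
by rewrite -abszE ltz_nat.
Qed.

Lemma idealI2_act0 (X Y : modO A) (bX : hbasis X) (bY : hbasis Y) :
  exists N : nat, forall n t, (N <= n)%N -> idealI2 n t ->
    forall x : tensor X Y, tact (tswap t) x = 0.
Proof.
have [NX hX] := idealI_act0 bX; have [NY hY] := idealI_act0 bY.
exists (maxn NX NY) => n t; rewrite geq_max => /andP[nX nY].
suff h : idealI2 n `<=` [set t | forall x : tensor X Y, tact (tswap t) x = 0].
  by move=> /h.
apply: lspan_min.
  split=> [x|c s u hs hu x] /=.
    by rewrite (linear_0 (@tswap_linear _ _ _)) (linear_0 (@tact_linl _ _ _ _ x)).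
  by rewrite tswap_linear tact_linl hs hu scaler0 addr0.
move=> _ [a [b [hab ->]]] x; rewrite tswap_tens.
move: x; apply: tens_ext => [||u v]; first exact: tact_linr.
  by move=> c u v; rewrite scaler0 addr0.
rewrite tact_tens tmap_tens; try exact: act_linr.
(* After the swap [a] acts on [Y] and [b] on [X], whence the crossed use of [hY] and [hX]. *)
case: hab => h.
  by rewrite (hY _ _ nY h) (linear_0 (tens_linr _)).
by rewrite (hX _ _ nX h) (linear_0 (tens_linl _)).
Qed.

Variable r : ctens A.

Lemma tact_ctens_const (X Y : modO A) (bX : hbasis X) (bY : hbasis Y) :
  exists N : nat, forall n, (N <= n)%N ->
    forall x : tensor X Y, tact (tswap (r n)) x = tact (tswap (r N)) x.
Proof.
have [N hN] := idealI2_act0 bX bY; exists N => n Nn x.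
have := hN N _ (leqnn N) (hseq_compat r Nn) x.
have -> : r n - r N = (-1) *: r N + r n by rewrite scaleN1r addrC.
rewrite tswap_linear tact_linl scaleN1r addrC => /eqP.
by rewrite subr_eq0 => /eqP.
Qed.

(** Two eventual values agree at a common large index, so the [xget] in [flip_act] picks the stable
    value and not its default 0; all large [n] give the same matrix. *)
Lemma flip_actE (X Y : modO A) (bX : hbasis X) (bY : hbasis Y) :
  exists N : nat, forall n, (N <= n)%N ->
    flip_act r (bX := bX) (bY := bY) = op4_of (bX := bX) (bY := bY) (tact (tswap (r n))).
Proof.
have [N hN] := tact_ctens_const bX bY; exists N => n Nn.
apply/funext => i; apply/funext => j; apply/funext => k; apply/funext => l.
rewrite /flip_act; apply: xget_unique => /=.
  exists N => // m /= Nm; rewrite /op4_of.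
  by rewrite hN // [in RHS]hN.
move=> c [M _ hM]; rewrite -(hM (maxn M N)) /=; last exact: leq_maxl.
by rewrite /op4_of hN ?leq_maxr // [in RHS]hN.
Qed.

(** Swapping the factors in R Delta(a) = Delta^op(a) R gives R^21 Delta^op(a) = Delta(a) R^21, and P
    carries the action of Delta(a) to that of Delta^op(a). *)
Lemma braiding_ahom (X Y : modO A) (bX : hbasis X) (bY : hbasis Y) :
  quasitriangular r -> exists N : nat, forall n, (N <= n)%N ->
  @ahom _ _ (tensmod (phopf A) Y X) (tensmod (phopf A) X Y)
    (fun z => tact (tswap (r n)) (tswap z)).
Proof.
move=> qt; have [N1 h1] := tact_ctens_const bX bY.
have [N2 h2] := idealI2_act0 bX bY; exists N1 => n Nn; split.
  by apply: comp_linear; [exact: tact_linr|exact: tswap_linear].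
move=> a z /=; have [M _ hM] := qt_comul qt a N2.
(* The bound [M] for the relation depends on [a], whereas [n] is fixed; past [N1] the actions of
   [r n] and [r m] coincide, so [m] may replace [n]. *)
pose m := maxn M N1.
have mE x : tact (tswap (r n)) x = tact (tswap (r m)) x :> tensor X Y.
  by rewrite h1 // [RHS]h1 ?leq_maxr.
rewrite !mE tswap_tact -!tactM.
rewrite -{2}(tswapK (comul _ a)) -!tswap_mul2.
have := h2 N2 _ (leqnn _) (hM m (leq_maxl _ _)) (tswap z).
set s := mul2 _ _; set t := mul2 _ _.
have -> : s - t = (-1) *: t + s by rewrite scaleN1r addrC.
rewrite tswap_linear tact_linl scaleN1r addrC => /eqP.
by rewrite subr_eq0 => /eqP.
Qed.

End Braiding.

(** * Matrices of operators on a tensor product of modules with bases *)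

Section MatrixCoefficients.
Variables (C : numFieldType) (A : polarized C).

Variables (X Y : modO A) (bX : hbasis X) (bY : hbasis Y).
Implicit Types (i j : 'I_(hdim bX)) (k l : 'I_(hdim bY)).

Lemma hco_bilinear i k :
  (forall y, linear (fun x : X => hco i x * hco k y : C^o)) /\
  (forall x, linear (fun y : Y => hco i x * hco k y : C^o)).
Proof.
split=> [y|x] c u v /=; first by rewrite hco_scalar mulrDl -mulrA.
by rewrite hco_scalar mulrDr mulrCA.
Qed.

Lemma tcoord_linear i k : linear (@tcoord _ _ _ _ bX bY i k).
Proof. by have [? ?] := hco_bilinear i k; apply: tlift_linear. Qed.

Lemma tcoord_tens i k x y : tcoord i k (tens x y) = hco i x * hco k y.
Proof. by have [? ?] := hco_bilinear i k; apply: tlift_tens. Qed.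

Lemma tcoord_span (x : tensor X Y) :
  x = \sum_i \sum_k (tcoord i k x : C) *: tens (@hvec _ _ _ bX i) (@hvec _ _ _ bY k).
Proof.
move: x; apply: tens_ext => [//||u v].
  move=> c u v; rewrite scaler_sumr -big_split; apply: eq_bigr => i _ /=.
  rewrite scaler_sumr -big_split; apply: eq_bigr => k _ /=.
  by rewrite tcoord_linear scalerA -scalerDl.
rewrite {1}(hvec_span bX u) (linear_sum _ _ (tens_linl v)); apply: eq_bigr => i _.
rewrite {1}(hvec_span bY v) (linear_sum _ _ (tens_linr _)); apply: eq_bigr => k _.
rewrite (linear_Z _ _ (tens_linr _)) (linear_Z _ _ (tens_linl _)) scalerA tcoord_tens.
by rewrite mulrC.
Qed.

Lemma op4_of_comp (F G : tensor X Y -> tensor X Y) : linear F ->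
  op4_of (bX := bX) (bY := bY) (fun x => F (G x)) =
  op4_mul (op4_of (bX := bX) (bY := bY) F) (op4_of (bX := bX) (bY := bY) G).
Proof.
move=> lF; apply/funext => i; apply/funext => j; apply/funext => k; apply/funext => l.
rewrite /op4_of /op4_mul {1}(tcoord_span (G _)).
have lt := comp_linear (tcoord_linear i k) lF.
rewrite (linear_sum _ _ lt); apply: eq_bigr => p _.
rewrite (linear_sum _ _ lt); apply: eq_bigr => q _.
by rewrite (linear_Z _ _ lt) /= mulrC.
Qed.

End MatrixCoefficients.

(** In matrix form, passing from F to F^21 is conjugation by P. *)
Lemma op4_flip_of (C : numFieldType) (A : polarized C) (X Y : modO A)
    (bX : hbasis X) (bY : hbasis Y) (F : tensor X Y -> tensor X Y) :
  op4_flip (op4_of (bX := bX) (bY := bY) F) =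
  op4_of (bX := bY) (bY := bX) (fun x => tswap (F (tswap x))).
Proof.
apply/funext => k; apply/funext => l; apply/funext => i; apply/funext => j.
rewrite /op4_flip /op4_of tswap_tens; move: (F _).
apply: (@tens_ext _ _ _ C^o) => [||x y].
- exact: tcoord_linear.
- by apply: comp_linear; [exact: tcoord_linear|exact: tswap_linear].
by rewrite tswap_tens !tcoord_tens mulrC.
Qed.

(** * Isotypic projections: finiteness, naturality, exchange with R^21 *)

Section Isotypic.
Variables (C : numFieldType) (A : polarized C).
Variables (O0 : modO A -> Prop) (sO0 : semisimple_tensor_subcategory O0).
Variables (Ir : irreps O0) (tb : taubar_type Ir) (ptb : is_taubar tb).
Arguments tb : clear implicits.
Local Notation md := (@ir_mod _ _ _ Ir).
Local Notation bs := (@ir_basis _ _ _ Ir).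
Local Notation WV W V := (tensmod (phopf A) (md W) (md V)).

Lemma tau_linear (M N : amod A) : linear (@tau _ _ M N).
Proof.
by apply: tlift_linear => [v|h] c x y //; have /asboolP[-> _] := valP h.
Qed.

Lemma tau_tens (M N : amod A) (h : homA M N) x : tau (tens h x) = h x.
Proof. by apply: tlift_tens => [v|g] c u v' //; have /asboolP[-> _] := valP g. Qed.

(** W (x) V is isomorphic to an object of the semisimple category, and each simple summand is
    isomorphic to some representative; the types [u] do not depend on [x]. *)
Lemma tensor_isotypic (W V : Ir) : exists n (u : 'I_n -> Ir), forall x : WV W V,
  exists y : forall k, tensor (homA (md (u k)) (WV W V)) (md (u k)),
    x = \sum_k tau (y k).
Proof.
have [Z OZ [f [lf Af] [f' fK f'K]]] := O0_tens sO0 (ir_in W) (ir_in V).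
have [n [S [s [Ss sP]]]] := O0_semisimple sO0 OZ.
have /choice[u uP] : forall k, exists U, aiso (S k) (md U).
  by move=> k; have [? ? _] := Ss k; exact: ir_all.
exists n, u => x; have [c [xE _]] := sP (f' x).
suff h k : exists y : tensor (homA (md (u k)) (WV W V)) (md (u k)),
    tau y = f (s k (c k)).
  have [y yE] := fin_all_exists h; exists y.
  rewrite -[LHS]f'K xE (linear_sum _ _ lf).
  by apply: eq_bigr => k _; rewrite yE.
have [_ _ [ls As]] := Ss k; have [g [lg Ag] [g' gK g'K]] := uP k.
(* The composite U -> S_k -> Z -> W (x) V is the element of the Hom space that produces the k-th
   component. *)
have hP : (fun z => f (s k (g' z))) \in @is_ahom _ _ (md (u k)) (WV W V).
  apply/asboolP; split=> [a z z'|a z].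
    by rewrite -{1}(g'K z) -{1}(g'K z') -lg gK ls lf.
  by rewrite -{1}(g'K z) -Ag gK As Af.
by exists (tens (HomA hP) (g (c k))); rewrite tau_tens /= gK.
Qed.

Lemma taubar_finite (W V : Ir) : exists s : {fset Ir}, forall U,
  U \notin s -> forall x, tb W V U x = 0.
Proof.
have [lt _ t0] := ptb W V; have [n [u uP]] := tensor_isotypic W V.
exists [fset u k | k in 'I_n]%fset => U Us x.
have [y ->] := uP x; rewrite (linear_sum _ _ (lt U)) big1 // => k _.
apply: t0 => ukU; move/negP: Us; apply; rewrite -ukU.
by apply/imfsetP; exists k.
Qed.

(** The operator whose matrix is [iso_coef], so that naturality can be stated without
    coordinates. *)
Definition iso_op (W V U : Ir) (p q : 'I_(hdim (bs U))) (x : WV W V) : WV W V :=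
  tau (tmap id (fun u => hco q u *: hvec p) (tb W V U x)).

Lemma iso_op_linear (W V U : Ir) p q : linear (@iso_op W V U p q).
Proof.
have [lt _ _] := ptb W V; apply: (comp_linear (@tau_linear _ _)).
apply: comp_linear (lt U); apply: tmap_linear => // c x y.
by rewrite hco_scalar scalerDl scalerA.
Qed.

(** It suffices to treat h(m) with h : U' -> W (x) V. As b h is again a homomorphism from U', both
    sides are b(h(E_pq m)) if U' = U, and 0 otherwise. *)
Lemma iso_op_natural (W V W' V' U : Ir) p q (b : WV W V -> WV W' V') : ahom b ->
  forall x, iso_op (U := U) p q (b x) = b (iso_op p q x).
Proof.
move=> [lb Ab] x; have [n [u uP]] := tensor_isotypic W V.
have lE : linear (fun u : md U => hco q u *: hvec p : md U).
  by move=> c y z; rewrite hco_scalar scalerDl scalerA.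
have l1 := comp_linear (@iso_op_linear W' V' U p q) lb.
have l2 := comp_linear lb (@iso_op_linear W V U p q).
have [y ->] := uP x; rewrite (linear_sum _ _ l1) (linear_sum _ _ l2).
apply: eq_bigr => k _; move: (y k) => {y}; move: (u k) => U'.
apply: tens_ext => [||h m].
- exact: comp_linear l1 (@tau_linear _ _).
- exact: comp_linear l2 (@tau_linear _ _).
have hP : (fun z => b (h z)) \in @is_ahom _ _ (md U') (WV W' V').
  have /asboolP[lh Ah] := valP h.
  by apply/asboolP; split=> [a z z'|a z]; rewrite ?lh ?lb ?Ah ?Ab.
have -> : b (tau (tens h m)) = tau (tens (HomA hP) m) by rewrite !tau_tens.
have [_ t1 t0] := ptb W V; have [_ t1' t0'] := ptb W' V'.
rewrite /iso_op; have [UU'|/eqP UU'] := eqVneq U' U.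
  by subst U'; rewrite t1 t1' !tmap_tens // !tau_tens.
rewrite t0 // t0' // !(linear_0 (tmap_linear _ _)) //.
by rewrite !(linear_0 (@tau_linear _ _)) (linear_0 lb).
Qed.

Variables (r : ctens A) (qt : quasitriangular r).

(** This is R^21 K^21 = K R^21 for the coefficient of L^U_pq: naturality applied to the braiding
    R^21 P from W (x) V to V (x) W. *)
Lemma iso_coef_exchange (V W U : Ir) (p q : 'I_(hdim (bs U))) :
  op4_mul (flip_act r (bX := bs V) (bY := bs W))
    (op4_flip (iso_coef tb (W := W) (V := V) p q)) =
  op4_mul (iso_coef tb (W := V) (V := W) p q)
    (flip_act r (bX := bs V) (bY := bs W)).
Proof.
have [N1 h1] := flip_actE r (bs V) (bs W).
have [N2 h2] := braiding_ahom (bs V) (bs W) qt.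
pose n := maxn N1 N2; rewrite (h1 n (leq_maxl _ _)).
have hb := h2 n (leq_maxr _ _).
rewrite /iso_coef op4_flip_of -!op4_of_comp; last first.
- exact: tact_linr.
- exact: iso_op_linear.
congr op4_of; apply/funext => x.
have := iso_op_natural (U := U) p q hb (tswap x).
by rewrite /iso_op tswapK => ->.
Qed.

End Isotypic.

(** * The algebra of matrices with two pairs of indices *)

Section Op4.
Variables (S : pzRingType) (m n : nat).
Implicit Types X Y Z : op4 S m n.

(** Indexing by pairs makes this an ordinary matrix product with one summation. *)
Lemma op4_mulE X Y i j k l :
  op4_mul X Y i j k l =
  \sum_(s : 'I_m * 'I_n) X i s.1 k s.2 * Y s.1 j s.2 l.
Proof. by rewrite /op4_mul pair_bigA. Qed.

Lemma op4_mulA X Y Z : op4_mul X (op4_mul Y Z) = op4_mul (op4_mul X Y) Z.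
Proof.
apply/funext => i; apply/funext => j; apply/funext => k; apply/funext => l.
rewrite !op4_mulE.
under eq_bigr do rewrite op4_mulE mulr_sumr.
rewrite exchange_big; apply: eq_bigr => s _ /=.
by rewrite op4_mulE mulr_suml; apply: eq_bigr => t _; rewrite mulrA.
Qed.

Lemma op4_1mul X : op4_mul (@op4_one S m n) X = X.
Proof.
apply/funext => i; apply/funext => j; apply/funext => k; apply/funext => l.
rewrite op4_mulE (bigD1 (i, k)) //= /op4_one !eqxx mul1r big1 ?addr0 // => s.
rewrite -pair_eqE /= => /negPf; rewrite [s.1 == i]eq_sym [s.2 == k]eq_sym => ->.
by rewrite mul0r.
Qed.

Lemma op4_mul1 X : op4_mul X (@op4_one S m n) = X.
Proof.
apply/funext => i; apply/funext => j; apply/funext => k; apply/funext => l.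
rewrite op4_mulE (bigD1 (j, l)) //= /op4_one !eqxx mulr1 big1 ?addr0 // => s.
by rewrite -pair_eqE /= => /negPf ->; rewrite mulr0.
Qed.

Lemma op4_flip_mul X Y : op4_flip (op4_mul X Y) = op4_mul (op4_flip X) (op4_flip Y).
Proof.
apply/funext => k; apply/funext => l; apply/funext => i; apply/funext => j.
by rewrite /op4_flip /op4_mul exchange_big.
Qed.

Lemma op4_flip1 : op4_flip (@op4_one S m n) = @op4_one S n m.
Proof.
apply/funext => k; apply/funext => l; apply/funext => i; apply/funext => j.
by rewrite /op4_flip /op4_one andbC.
Qed.

End Op4.

(** * Normally ordered products in E and multiplication by functions *)

Section ExchangeRelations.
Variables (C : numFieldType) (A : polarized C).
Variables (O0 : modO A -> Prop) (Ir : irreps O0).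
Local Notation MT := (merof (palg0 A)).
Local Notation dim U := (hdim (@ir_basis _ _ _ Ir U)).
Local Notation E := (exch Ir).

Lemma exelt_linl (U : Ir) (p q : 'I_(dim U)) g : linear (fun f : MT => exelt f g p q).
Proof. by move=> c f f'; rewrite /exelt tens_linl tens_linl. Qed.

Lemma exelt_linr (U : Ir) (p q : 'I_(dim U)) f : linear (fun g : MT => exelt f g p q).
Proof. by move=> c g g'; rewrite /exelt tens_linr tens_linl. Qed.

Definition op4_cst m n (c : op4 C m n) : op4 MT m n :=
  fun i j k l => c i j k l *: (1 : MT).

(* [: X(lambda^1) (K (x) L_pq) Y(lambda^2) :] *)
Definition sandwich m n (U : Ir) (p q : 'I_(dim U)) (X : op4 MT m n)
    (K : op4 C m n) (Y : op4 MT m n) : op4 E m n :=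
  fun i j k l => \sum_a \sum_b \sum_c \sum_d
    K a c b d *: exelt (X i a k b) (Y c j d l) p q.

Section Sandwich.
Variables (m n : nat) (U : Ir) (p q : 'I_(dim U)).
Implicit Types (X Y : op4 MT m n) (K c : op4 C m n).

Lemma sandwichE X K Y i j k l :
  sandwich p q X K Y i j k l = \sum_(s : 'I_m * 'I_n) \sum_(t : 'I_m * 'I_n)
    K s.1 t.1 s.2 t.2 *: exelt (X i s.1 k s.2) (Y t.1 j t.2 l) p q.
Proof.
rewrite /sandwich pair_bigA; apply: eq_bigr => s _.
by rewrite pair_bigA.
Qed.

Lemma sandwich_flip X K Y i j k l :
  sandwich p q X K Y i j k l =
  sandwich p q (op4_flip X) (op4_flip K) (op4_flip Y) k l i j.
Proof.
rewrite /sandwich exchange_big; apply: eq_bigr => b _; apply: eq_bigr => a _.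
by rewrite exchange_big.
Qed.

(** Relates the product of M_T to its separately defined scaling by C, by computing with
    representing functions. *)
Lemma mmul_cst (f : MT) (a : C) : f * (a *: (1 : MT) : MT) = a *: f.
Proof.
have [g ->] := meroclass_surj f.
have -> : a *: (1 : MT) = meroclass (a *: (1 : mfun (palg0 A)) : mfun _) by rewrite /meroclass linearZ.
have -> : a *: meroclass g = meroclass (a *: g) by rewrite /meroclass linearZ.
rewrite -[LHS]/(mmul _ _) mmulE; congr meroclass; apply/val_inj/funext => x.
by rewrite -[LHS]/(g x * (a * 1)) -[RHS]/(a * g x) mulr1 mulrC.
Qed.

(** [exelt] is C-linear in each function, so a constant matrix moves from the outer factors into the
    middle; R^21 reaches the isotypic coefficients in this way. *)
Lemma sandwich_cstl X c K Y :
  sandwich p q (op4_mul X (op4_cst c)) K Y = sandwich p q X (op4_mul c K) Y.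
Proof.
apply/funext => i; apply/funext => j; apply/funext => k; apply/funext => l.
rewrite !sandwichE exchange_big [RHS]exchange_big; apply: eq_bigr => t _ /=.
under eq_bigr do rewrite op4_mulE (linear_sum _ _ (exelt_linl _ _ _)) scaler_sumr.
rewrite exchange_big; apply: eq_bigr => s _ /=.
rewrite op4_mulE scaler_suml; apply: eq_bigr => u _ /=.
by rewrite mmul_cst (linear_Z _ _ (exelt_linl _ _ _)) scalerA mulrC.
Qed.

Lemma sandwich_cstr X c K Y :
  sandwich p q X K (op4_mul (op4_cst c) Y) = sandwich p q X (op4_mul K c) Y.
Proof.
apply/funext => i; apply/funext => j; apply/funext => k; apply/funext => l.
rewrite !sandwichE; apply: eq_bigr => s _ /=.
under eq_bigr do rewrite op4_mulE (linear_sum _ _ (exelt_linr _ _ _)) scaler_sumr.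
rewrite exchange_big; apply: eq_bigr => t _ /=.
rewrite op4_mulE scaler_suml; apply: eq_bigr => u _ /=.
by rewrite [_ * Y _ _ _ _]mulrC mmul_cst (linear_Z _ _ (exelt_linr _ _ _)) scalerA.
Qed.

End Sandwich.

Variables (J Ji : op4_family Ir) (tb : taubar_type Ir) (mul : E -> E -> E).
Arguments J : clear implicits.
Arguments Ji : clear implicits.
Hypothesis pmul : exchange_product J Ji tb mul.

Lemma exfun1_exelt f g h (U : Ir) (p q : 'I_(dim U)) :
  mul (exfun1 f) (exelt g h p q) = exelt (f * g) h p q.
Proof.
by rewrite -(ex_elt pmul) (ex_assoc pmul) (ex_fun11 pmul) (ex_elt pmul).
Qed.

Lemma exfun2_exelt f g h (U : Ir) (p q : 'I_(dim U)) :
  mul (exfun2 f) (exelt g h p q) = exelt g (f * h) p q.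
Proof.
(* The function of lambda^2 must first pass the function of lambda^1 to its right. *)
rewrite -(ex_elt pmul) (ex_assoc pmul) -(ex_fun12 pmul) -(ex_assoc pmul).
by rewrite (ex_assoc pmul (exfun2 f)) (ex_fun22 pmul) (ex_elt pmul).
Qed.

(** Multiplying by functions on the left keeps the normal order, so [R] is absorbed into the matrix
    in lambda^1. *)
Lemma exfun1_sandwich m n (U : Ir) (p q : 'I_(dim U)) (R X : op4 MT m n) K Y i j k l :
  \sum_a \sum_b mul (exfun1 (R i a k b)) (sandwich p q X K Y a j b l) =
  sandwich p q (op4_mul R X) K Y i j k l.
Proof.
rewrite pair_bigA /= sandwichE.
under eq_bigr => u _.
  rewrite sandwichE (linear_sum _ _ (ex_linr pmul _)).
  under eq_bigr => s _.
    rewrite (linear_sum _ _ (ex_linr pmul _)).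
    under eq_bigr do rewrite (linear_Z _ _ (ex_linr pmul _)) exfun1_exelt.
    over.
  over.
rewrite exchange_big; apply: eq_bigr => s _ /=.
rewrite exchange_big; apply: eq_bigr => t _ /=.
by rewrite op4_mulE (linear_sum _ _ (exelt_linl _ _ _)) scaler_sumr.
Qed.

Lemma exfun2_sandwich m n (U : Ir) (p q : 'I_(dim U)) (R X : op4 MT m n) K Y i j k l :
  \sum_a \sum_b mul (exfun2 (R a j b l)) (sandwich p q X K Y i a k b) =
  sandwich p q X K (op4_mul Y R) i j k l.
Proof.
rewrite pair_bigA /= sandwichE.
under eq_bigr => u _.
  rewrite sandwichE (linear_sum _ _ (ex_linr pmul _)).
  under eq_bigr => s _.
    rewrite (linear_sum _ _ (ex_linr pmul _)).
    (* The entry of [R] arrives in front of that of [Y]; commutativity of M_T restores the matrix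
       order [Y R]. *)
    under eq_bigr do rewrite (linear_Z _ _ (ex_linr pmul _)) exfun2_exelt mulrC.
    over.
  over.
rewrite exchange_big; apply: eq_bigr => s _ /=.
rewrite exchange_big; apply: eq_bigr => t _ /=.
by rewrite op4_mulE (linear_sum _ _ (exelt_linr _ _ _)) scaler_sumr.
Qed.

Hypothesis sO0 : semisimple_tensor_subcategory O0.
Hypothesis ptb : is_taubar tb.

Lemma exLL (V W : Ir) : exists s : {fset Ir}, forall s', (s `<=` s')%fset ->
  forall i j k l, mul (@exL _ _ _ Ir V i j) (@exL _ _ _ Ir W k l) =
    \sum_(U <- s') \sum_(p < dim U) \sum_(q < dim U)
      sandwich p q (Ji W V) (iso_coef tb (W := W) (V := V) p q) (J W V) k l i j.
Proof.
have [s sP] := taubar_finite sO0 ptb W V; exists s => s' ss' i j k l.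
rewrite (ex_LL pmul); apply: fsbigTE => U Us'.
rewrite big1 // => p _; rewrite big1 // => q _.
rewrite big1 // => a _; rewrite big1 // => b _; rewrite big1 // => c _.
rewrite big1 // => d _.
have -> : iso_coef tb p q a c b d = 0.
  rewrite /iso_coef /op4_of sP; last by apply: contra Us'; exact: (fsubsetP ss').
  have lE : linear (fun u : ir_mod U => hco q u *: @hvec _ _ _ (ir_basis U) p).
    by move=> e y z; rewrite hco_scalar scalerDl scalerA.
  rewrite (linear_0 (tmap_linear _ lE)) // (linear_0 (@tau_linear _ _ _ _)).
  by rewrite (linear_0 (@tcoord_linear _ _ _ _ _ _ _ _)).
by rewrite scale0r.
Qed.

End ExchangeRelations.

(** * The exchange relation, by cancelling fusion matrices coefficient by coefficient *)

Theorem theorem22 (R : realType) (A : polarized R[i]) (nd : nondegenerate_polarized A)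
    (cT : zconnected (palg0 A))
    (r : ctens A) (qt : quasitriangular r) (ul : upper_lower r)
    (O0 : modO A -> Prop) (sO0 : semisimple_tensor_subcategory O0)
    (Ir : irreps O0)
    (J Ji : op4_family Ir)
    (fJ : forall W V : Ir, fusion_matrix (J W V) (Ji W V))
    (tb : taubar_type Ir) (ptb : is_taubar tb)
    (mul : exch Ir -> exch Ir -> exch Ir) (pmul : exchange_product J Ji tb mul)
    (V W : Ir)
    (i j' : 'I_(hdim (ir_basis V))) (k l' : 'I_(hdim (ir_basis W))) :
  let RVW := exchange_matrix J Ji r V W in
  \sum_j \sum_l mul (exfun1 (RVW i j k l)) (mul (exL j j') (exL l l')) =
  \sum_j \sum_l mul (exfun2 (RVW j j' l l')) (mul (exL k l) (exL i j)).
Proof.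
move=> RVW.
have [s1 h1] := exLL pmul sO0 ptb V W; have [s2 h2] := exLL pmul sO0 ptb W V.
pose s := (s1 `|` s2)%fset.
have sum_mul z (F : forall U : Ir, 'I_(hdim (ir_basis U)) ->
    'I_(hdim (ir_basis U)) -> exch Ir) :
  mul z (\sum_(U <- s) \sum_p \sum_q F U p q) =
  \sum_(U <- s) \sum_p \sum_q mul z (F U p q).
  rewrite (linear_sum _ _ (ex_linr pmul z)); apply: eq_bigr => U _.
  rewrite (linear_sum _ _ (ex_linr pmul z)); apply: eq_bigr => p _.
  by rewrite (linear_sum _ _ (ex_linr pmul z)).
under eq_bigr do under eq_bigr do rewrite (h1 s) ?fsubsetUl // sum_mul.
under [RHS]eq_bigr do under eq_bigr do rewrite (h2 s) ?fsubsetUr // sum_mul.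
(* From here both sides are compared for each L^U_pq separately. *)
rewrite !pair_bigA /= exchange_big [RHS]exchange_big; apply: eq_bigr => U _ /=.
rewrite exchange_big [RHS]exchange_big; apply: eq_bigr => p _ /=.
rewrite exchange_big [RHS]exchange_big; apply: eq_bigr => q _ /=.
rewrite -(pair_bigA _ (fun j l => mul (exfun1 (RVW i j k l)) (sandwich p q (Ji W V)
  (iso_coef tb (W := W) (V := V) p q) (J W V) l l' j j'))) /=.
rewrite -(pair_bigA _ (fun j l => mul (exfun2 (RVW j j' l l')) (sandwich p q (Ji V W)
  (iso_coef tb (W := V) (V := W) p q) (J V W) i j k l))) /=.
(* The expansion of L^V L^W lives on W (x) V; the flip brings it to V (x) W, where [RVW] acts. *)
under eq_bigr do under eq_bigr do rewrite sandwich_flip.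
rewrite (exfun1_sandwich pmul) (exfun2_sandwich pmul).
(* On the left J^21_{W,V} cancels, leaving J_{V,W}^{-1} R^21. *)
have -> : op4_mul RVW (op4_flip (Ji W V)) = op4_mul (Ji V W)
    (op4_cst A (flip_act r (bX := ir_basis V) (bY := ir_basis W))).
  rewrite /RVW /exchange_matrix -op4_mulA -(op4_flip_mul (J W V)) (fusion_invr (fJ W V)).
  by rewrite op4_flip1 op4_mul1.
(* On the right J_{V,W} cancels, leaving R^21 J^21_{W,V}. *)
have -> : op4_mul (J V W) RVW =
    op4_mul (op4_cst A (flip_act r (bX := ir_basis V) (bY := ir_basis W)))
      (op4_flip (J W V)).
  rewrite /RVW /exchange_matrix !op4_mulA (fusion_invr (fJ V W)).
  by rewrite op4_1mul.
by rewrite sandwich_cstl sandwich_cstr (iso_coef_exchange sO0 ptb qt).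
Qed.
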